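(* Let $T\in \mathrm{PU}(n,1)$ be a holomorphic isometry of complex hyperbolic space $\mathrm{H}_{\mathbb C}^n$. Then $T$ is a product (in $\mathrm{PU}(n,1)$) of at most two reversible elements and a complex $k$-reflection, where $k\le 2$; here $k=0$ if $T$ is elliptic; $k=1$ if $T$ is an ellipto-translation or hyperbolic; $k=2$ if $T$ is ellipto-parabolic and $n>2$.
   Context: $\mathbb C^{n,1}$ is $\mathbb C^{n+1}$ with the Hermitian form $\langle z,w\rangle=\overline w^{t}Jz$, $J=\mathrm{diag}(-1,1,\dots,1)$. $\mathrm U(n,1)=\{A\in \mathrm{GL}(n+1,\mathbb C): \overline A^{t}JA=J\}$ and $\mathrm{PU}(n,1)=\mathrm U(n,1)/\{\lambda I:|\lambda|=1\}$. $\mathrm{H}_{\mathbb C}^n$ is the set of lines in $\mathbb P(\mathbb C^{n,1})$ spanned by negative vectors ($\langle z,z\rangle<0$), and $\partial \mathrm{H}_{\mathbb C}^n$ is the set of lines spanned by nonzero null vectors ($\langle z,z\rangle=0$). $\mathrm{PU}(n,1)$ acts by holomorphic isometries on $\mathrm{H}_{\mathbb C}^n$ and on its boundary. An element $g$ of a group $G$ is reversible if $g$ is conjugate in $G$ to $g^{-1}$. $T$ is elliptic if it has a fixed point in $\mathrm{H}_{\mathbb C}^n$; parabolic if it fixes a single point of $\overline{\mathrm{H}_{\mathbb C}^n}$ and that point lies on $\partial\mathrm{H}_{\mathbb C}^n$; hyperbolic if it fixes exactly two points of $\overline{\mathrm{H}_{\mathbb C}^n}$ and both lie on $\partial\mathrm{H}_{\mathbb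 C}^n$. An eigenvalue is null if the Hermitian form restricted to its eigenspace is degenerate. If $T$ is parabolic and none of its lifts to $\mathrm U(n,1)$ is unipotent, a lift has a null eigenvalue $\lambda$, $|\lambda|=1$, and there is an invariant orthogonal decomposition $\mathbb C^{n,1}=\mathbb U\oplus\mathbb W$ with the lift semisimple on $\mathbb W$, $\mathbb U$ indefinite (form non-degenerate and indefinite) of dimension $m\in\{2,3\}$, and both the characteristic and minimal polynomial on $\mathbb U$ equal to $(x-\lambda)^m$. $T$ is called an ellipto-translation if $m=2$ and ellipto-parabolic if $m=3$. A complex $k$-reflection is an element of $\mathrm U(n,1)$ (or the isometry it induces in $\mathrm{PU}(n,1)$) for which there is an orthogonal decomposition $\mathbb C^{n,1}=\mathbb U\oplus\mathbb U^{\perp}$ with $\dim \mathbb U=k+1$, $\mathbb U$ non-degenerate and containing negative vectors, such that the element acts on $\mathbb U$ as multiplication by a scalar $\lambda$ with $|\lambda|=1$ and on $\mathbb U^{\perp}$ (of dimension $n-k$) as the identity; $\lambda=1$ is allowed. *)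

(* Defs.v *)
From HB Require Import structures.
From mathcomp Require Import all_boot all_order all_algebra.
From mathcomp Require Import vector.
From mathcomp Require Import generic_quotient.
From mathcomp Require Import complex.
From mathcomp Require Import boolp classical_sets reals.

Set Implicit Arguments.
Unset Strict Implicit.
Unset Printing Implicit Defensive.

Import Order.TTheory GRing.Theory Num.Theory.

Local Open Scope ring_scope.
Local Open Scope complex_scope.
Local Open Scope quotient_scope.

Section HermitianSpace.
Variables (R : realType) (n : nat).
Local Notation C := R[i].
Local Notation V := 'cV[C]_n.+1.

Definition Jmx : 'M[C]_n.+1 :=
  diag_mx (\row_(j < n.+1) (if j == ord0 then -1 else 1)).

Definition conjtr p q (A : 'M[C]_(p, q)) : 'M[C]_(q, p) :=
  (map_mx Num.conj A)^T.

Definition herm (z w : V) : C := (conjtr w *m Jmx *m z) ord0 ord0.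

Definition nondegenerate (U : {vspace V}) : Prop :=
  forall u, u \in U -> (forall v, v \in U -> herm u v = 0) -> u = 0.

Definition indefinite (U : {vspace V}) : Prop :=
  (exists2 u, u \in U & herm u u < 0) /\ (exists2 v, v \in U & 0 < herm v v).

(* When U is nondegenerate, this forces W to be the orthogonal complement
   of U, and dim W = n + 1 - dim U. *)
Definition orthogonal_decomposition (U W : {vspace V}) : Prop :=
  [/\ (U + W)%VS = fullv, (U :&: W)%VS = 0%VS
    & forall u w, u \in U -> w \in W -> herm u w = 0].

Definition endo (A : 'M[C]_n.+1) : 'End(V) := linfun (mulmx A).

Definition invariant (A : 'M[C]_n.+1) (U : {vspace V}) : Prop :=
  (endo A @: U <= U)%VS.

(* The matrix, in the basis e, of the restriction of z |-> A *m z to the span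
   of e.  It is meaningful only when that span is invariant under A. *)
Definition restriction_mx m (e : m.-tuple V) (A : 'M[C]_n.+1) : 'M[C]_m :=
  \matrix_(i, j) coord e i (A *m tnth e j).

Definition semisimple_on (A : 'M[C]_n.+1) (W : {vspace V}) : Prop :=
  diagonalizable (restriction_mx (vbasis W) A).

Definition null_eigenvalue (A : 'M[C]_n.+1) (lambda : C) : Prop :=
  passmx.leigenvalue (endo A) lambda /\ ~ nondegenerate (passmx.leigenspace (endo A) lambda).

Definition unipotent (A : 'M[C]_n.+1) : Prop := exists N, (A - 1) ^+ N = 0.

(* mxminpoly only exists for matrices of size m.+1, hence the indexing:
   the span of e has dimension m + 1. *)
Definition single_jordan_block m (A : 'M[C]_n.+1) (U : {vspace V})
    (lambda : C) : Prop :=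
  exists2 e : m.+1.-tuple V, basis_of U e &
    char_poly (restriction_mx e A) = ('X - lambda%:P) ^+ m.+1 /\
    mxminpoly (restriction_mx e A) = ('X - lambda%:P) ^+ m.+1.

End HermitianSpace.

Section UnitaryGroup.
Variables (R : realType) (n : nat).
Local Notation C := R[i].
Local Notation J := (Jmx R n).

Definition unitary_form (A : 'M[C]_n.+1) : bool :=
  (A \in unitmx) && (conjtr A *m J *m A == J).

Definition U_n1 := {A : 'M[C]_n.+1 | unitary_form A}.
HB.instance Definition _ := SubChoice.on U_n1.

Lemma conjtrM p q r (A : 'M[C]_(p, q)) (B : 'M[C]_(q, r)) :
  conjtr (A *m B) = conjtr B *m conjtr A.
Proof. by rewrite /conjtr map_mxM trmx_mul. Qed.

Lemma conjtr1 p : conjtr (1%:M : 'M[C]_p) = 1%:M.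
Proof. by rewrite /conjtr map_mx1 trmx1. Qed.

Lemma unitary_form1 : unitary_form 1%:M.
Proof. by rewrite /unitary_form unitmx1 conjtr1 mul1mx mulmx1 eqxx. Qed.

Lemma unitary_formM (A B : 'M[C]_n.+1) :
  unitary_form A -> unitary_form B -> unitary_form (A *m B).
Proof.
case/andP=> uA /eqP fA /andP[uB /eqP fB]; rewrite /unitary_form unitmx_mul uA uB.
rewrite conjtrM -!mulmxA (mulmxA J) (mulmxA (conjtr A)) (mulmxA (conjtr A)).
by rewrite fA mulmxA fB eqxx.
Qed.

Lemma unitary_formV (A : 'M[C]_n.+1) : unitary_form A -> unitary_form (invmx A).
Proof.
case/andP=> uA /eqP fA; rewrite /unitary_form unitmx_inv uA -{1}fA.
have cV : conjtr (invmx A) *m conjtr A = 1%:M by rewrite -conjtrM mulmxV // conjtr1.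
by rewrite !mulmxA cV mul1mx -mulmxA mulmxV // mulmx1 eqxx.
Qed.

Definition U_one : U_n1 := Sub 1%:M unitary_form1.
Definition U_mul (A B : U_n1) : U_n1 :=
  Sub (val A *m val B) (unitary_formM (valP A) (valP B)).
Definition U_inv (A : U_n1) : U_n1 := Sub (invmx (val A)) (unitary_formV (valP A)).

Lemma U_unit (A : U_n1) : val A \in unitmx.
Proof. by case/andP: (valP A). Qed.

Lemma U_mulA : associative U_mul.
Proof. by move=> A B D; apply/val_inj; rewrite /= mulmxA. Qed.
Lemma U_mul1 : left_id U_one U_mul.
Proof. by move=> A; apply/val_inj; rewrite /= mul1mx. Qed.
Lemma U_mulr1 : right_id U_one U_mul.
Proof. by move=> A; apply/val_inj; rewrite /= mulmx1. Qed.
Lemma U_mulV : left_inverse U_one U_inv U_mul.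
Proof. by move=> A; apply/val_inj; rewrite /= mulVmx ?U_unit. Qed.
Lemma U_mulrV : right_inverse U_one U_inv U_mul.
Proof. by move=> A; apply/val_inj; rewrite /= mulmxV ?U_unit. Qed.

HB.instance Definition _ :=
  isGroup.Build U_n1 U_mulA U_mul1 U_mulr1 U_mulV U_mulrV.

Lemma val_UM (A B : U_n1) : val (A * B)%g = val A *m val B.
Proof. by []. Qed.

Lemma val_UV (A : U_n1) : val A^-1%g = invmx (val A).
Proof. by []. Qed.

Definition proj_eq (A B : U_n1) : bool :=
  `[< exists2 lambda : C, `|lambda| = 1 & val A = lambda *: val B >].

Lemma proj_eq_refl : reflexive proj_eq.
Proof. by move=> A; apply/asboolP; exists 1; rewrite ?normr1 ?scale1r. Qed.

Lemma proj_eq_sym : symmetric proj_eq.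
Proof.
suff H A B : proj_eq A B -> proj_eq B A by move=> A B; apply/idP/idP; apply: H.
move=> /asboolP[l l1 AB]; apply/asboolP; exists l^-1; first by rewrite normfV l1 invr1.
by rewrite AB scalerA mulVf ?scale1r // -normr_eq0 l1 oner_eq0.
Qed.

Lemma proj_eq_trans : transitive proj_eq.
Proof.
move=> B A D /asboolP[l l1 AB] /asboolP[m m1 BD]; apply/asboolP.
by exists (l * m); [rewrite normrM l1 m1 mulr1 | rewrite AB BD scalerA].
Qed.

Canonical proj_equiv := EquivRel proj_eq proj_eq_refl proj_eq_sym proj_eq_trans.

Definition PU_n1 := {eq_quot proj_equiv}.
HB.instance Definition _ := Choice.on PU_n1.
HB.instance Definition _ := EqQuotient.on PU_n1.

Definition PU_of (A : U_n1) : PU_n1 := \pi_PU_n1 A.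

Lemma PU_ofP (A B : U_n1) :
  PU_of A = PU_of B <-> exists2 lambda : C, `|lambda| = 1 & val A = lambda *: val B.
Proof.
split=> [/eqmodP AB|AB]; first exact/asboolP.
by apply/eqmodP/asboolP.
Qed.

Lemma PU_repr (A : U_n1) :
  exists2 lambda : C, `|lambda| = 1 & val (repr (PU_of A)) = lambda *: val A.
Proof. by apply/PU_ofP; rewrite /PU_of reprK. Qed.

Definition PU_one : PU_n1 := PU_of 1%g.
Definition PU_mul (S T : PU_n1) : PU_n1 := PU_of (repr S * repr T)%g.
Definition PU_inv (T : PU_n1) : PU_n1 := PU_of (repr T)^-1%g.

Lemma PU_ofM_subproof (A B : U_n1) : PU_mul (PU_of A) (PU_of B) = PU_of (A * B)%g.
Proof.
apply/PU_ofP; have [l l1 eA] := PU_repr A; have [m m1 eB] := PU_repr B.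
exists (l * m); first by rewrite normrM l1 m1 mulr1.
by rewrite !val_UM eA eB -scalemxAl -scalemxAr scalerA.
Qed.

Lemma PU_ofV_subproof (A : U_n1) : PU_inv (PU_of A) = PU_of A^-1%g.
Proof.
apply/PU_ofP; have [l l1 eA] := PU_repr A.
exists l^-1; first by rewrite normfV l1 invr1.
by rewrite !val_UV eA invmxZ // -eA U_unit.
Qed.

Lemma PU_of_surj (T : PU_n1) : exists A, T = PU_of A.
Proof. by exists (repr T); rewrite /PU_of reprK. Qed.

Lemma PU_mulA : associative PU_mul.
Proof.
move=> S T W; have [A ->] := PU_of_surj S; have [B ->] := PU_of_surj T.
by have [D ->] := PU_of_surj W; rewrite !PU_ofM_subproof mulgA.
Qed.
Lemma PU_mul1 : left_id PU_one PU_mul.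
Proof. by move=> T; have [A ->] := PU_of_surj T; rewrite PU_ofM_subproof mul1g. Qed.
Lemma PU_mulr1 : right_id PU_one PU_mul.
Proof. by move=> T; have [A ->] := PU_of_surj T; rewrite PU_ofM_subproof mulg1. Qed.
Lemma PU_mulV : left_inverse PU_one PU_inv PU_mul.
Proof.
move=> T; have [A ->] := PU_of_surj T.
by rewrite PU_ofV_subproof PU_ofM_subproof mulVg.
Qed.
Lemma PU_mulrV : right_inverse PU_one PU_inv PU_mul.
Proof.
move=> T; have [A ->] := PU_of_surj T.
by rewrite PU_ofV_subproof PU_ofM_subproof mulgV.
Qed.

HB.instance Definition _ :=
  isGroup.Build PU_n1 PU_mulA PU_mul1 PU_mulr1 PU_mulV PU_mulrV.

Lemma PU_ofM (A B : U_n1) : PU_of (A * B)%g = (PU_of A * PU_of B)%g.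
Proof. by rewrite -PU_ofM_subproof. Qed.

Lemma PU_ofV (A : U_n1) : PU_of A^-1%g = (PU_of A)^-1%g.
Proof. by rewrite -PU_ofV_subproof. Qed.

Definition lift_of (A : U_n1) (T : PU_n1) : Prop := PU_of A = T.

End UnitaryGroup.

Section HyperbolicSpace.
Variables (R : realType) (n : nat).
Local Notation C := R[i].
Local Notation V := 'cV[C]_n.+1.
Local Notation PU := (PU_n1 R n).
Local Open Scope classical_set_scope.

(* Points of the projective space are one-dimensional subspaces of V. *)
Definition HCn : set {vspace V} :=
  [set L | exists2 z : V, herm z z < 0 & L = <[z]>%VS].

Definition boundary_HCn : set {vspace V} :=
  [set L | exists z : V, [/\ z != 0, herm z z = 0 & L = <[z]>%VS]].

Definition closure_HCn : set {vspace V} := HCn `|` boundary_HCn.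

Definition PU_act (T : PU) (L : {vspace V}) : {vspace V} :=
  (endo (val (repr T)) @: L)%VS.

Lemma PU_actE (A : U_n1 R n) (L : {vspace V}) :
  PU_act (PU_of A) L = (endo (val A) @: L)%VS.
Proof.
have [l l1 eA] := PU_repr A; rewrite /PU_act eA.
have l0 : l != 0 by rewrite -normr_eq0 l1 oner_eq0.
have E z : endo (l *: val A) z = l *: endo (val A) z.
  by rewrite !lfunE /= scalemxAl.
apply/eqP; rewrite eqEsubv; apply/andP; split; apply/subvP => _ /memv_imgP[z zL ->].
  by rewrite E memvZ // memv_img.
have -> : endo (val A) z = endo (l *: val A) (l^-1 *: z).
  by rewrite E linearZ /= scalerA divff // scale1r.
by rewrite memv_img // memvZ.
Qed.

Definition fixed_points (T : PU) : set {vspace V} :=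
  [set L | closure_HCn L /\ PU_act T L = L].

Definition elliptic (T : PU) : Prop := exists2 L, HCn L & PU_act T L = L.

Definition parabolic (T : PU) : Prop :=
  exists2 p, boundary_HCn p & fixed_points T = [set p].

Definition hyperbolic (T : PU) : Prop :=
  exists p q, [/\ boundary_HCn p, boundary_HCn q, p <> q
                & fixed_points T = [set p; q]].

(* As in single_jordan_block, the indefinite summand U has dimension m + 1:
   m = 1 for ellipto-translations, m = 2 for ellipto-parabolics. *)
Definition nonunipotent_parabolic (m : nat) (T : PU) : Prop :=
  [/\ parabolic T,
      forall A, lift_of A T -> ~ unipotent (val A)
    & exists (A : U_n1 R n) (lambda : C) (U W : {vspace V}),
      [/\ lift_of A T, null_eigenvalue (val A) lambda & `|lambda| = 1] /\
      [/\ orthogonal_decomposition U W,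
          invariant (val A) U /\ invariant (val A) W,
          semisimple_on (val A) W,
          nondegenerate U /\ indefinite U
        & single_jordan_block m (val A) U lambda]].

Definition ellipto_translation : PU -> Prop := nonunipotent_parabolic 1.

Definition ellipto_parabolic : PU -> Prop := nonunipotent_parabolic 2.

Definition complex_reflection_U (k : nat) (A : U_n1 R n) : Prop :=
  exists (U W : {vspace V}) (lambda : C),
    [/\ orthogonal_decomposition U W, \dim U = k.+1,
        nondegenerate U & exists2 u, u \in U & herm u u < 0] /\
    [/\ `|lambda| = 1,
        forall u, u \in U -> val A *m u = lambda *: u
      & forall w, w \in W -> val A *m w = w].

Definition complex_reflection (k : nat) (T : PU) : Prop :=
  exists2 A, lift_of A T & complex_reflection_U k A.

End HyperbolicSpace.

Definition reversible (G : groupType) (g : G) : Prop :=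
  exists h : G, (g ^ h)%g = g^-1%g.

(* Main.v *)
Require Import Defs.
From HB Require Import structures.
From mathcomp Require Import all_boot all_order all_algebra.
From mathcomp Require Import reals.
From mathcomp Require Import perm boolp classical_sets complex spectral ring.

Set Implicit Arguments.
Unset Strict Implicit.
Unset Printing Implicit Defensive.

Import Order.TTheory GRing.Theory Num.Theory.
Local Open Scope ring_scope.

(** The space splits orthogonally as [U + W], where both summands are invariant
    under a lift [A] of [T], [U] contains negative vectors and [W] is positive
    definite.  On [W] the lift is unitary, hence diagonal in an orthonormal
    basis, with entries [a_1, ..., a_m] of modulus 1.  Rescaling the lift, which
    does not change [T], makes the product of the [a_i] equal to 1.  With
    partial products [p_i = a_1 ... a_i] one then has
      [diag(a) = diag(p_1, p_1^-1, p_3, p_3^-1, ...)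
                 diag(1, p_2, p_2^-1, p_4, p_4^-1, ...)],
    and each factor is conjugate to its inverse by a permutation of the
    orthonormal basis ([inv_closed_factor], [diag_factor]).  It remains to write
    the restriction of [A] to [U] as [c (g1 g2)] with [|c| = 1] and [g1], [g2]
    reversible in the isometry group of [U]: then [T] is the product of two
    reversible elements, [g1] and [g2] extended by the two diagonal factors, and
    of the reflection acting as [c] on [U] and trivially on [W]
    ([product_of_frame]).  The reflection has [k = dim U - 1].

    The summand [U] is found as follows.
    - If [A] has a negative eigenvector, [U] is its span and [g1 = g2 = 1].
    - Otherwise [A] has a null eigenvector [p], say [A p = a p]: if all
      eigenvectors were positive, the space would have an orthonormal basis of
      positive vectors ([null_eigenvector]).  If [|a| <> 1], duality provides a
      second null eigenvector, of eigenvalue [1 / conj a] ([loxodromic_pair]);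
      then [U] is a hyperbolic plane on which [A] is a scalar times
      [diag(r, 1/r)], [r > 0], and the latter is reversed by the exchange of the
      two null lines.
    - If [|a| = 1], some generalized eigenvector [q] for [a] is not orthogonal
      to [p].  Since the form is positive semidefinite on the orthogonal of [p],
      with kernel [p], the Jordan chain of [q] reaches the line of [p] after at
      most two steps ([jordan_chain]).  One step gives a plane [U] on which [A]
      is [a] times a parabolic element of [SU(1,1)]; although not reversible,
      this element is the product of two hyperbolic, hence reversible, ones
      ([reversible_diag2], [reversible_upper2]).  Two steps give a
      three-dimensional [U] on which [A] is [a] times a Heisenberg translation;
      such a translation is the product of two Heisenberg translations
      without vertical part, and each of these is reversed by the rotation of
      angle pi ([heisenberg_factor], [reversible_heisenberg]).

    Finally [k] has to agree with the type of [T].  Elliptic isometries have a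
    fixed point inside, which parabolic and hyperbolic ones have not.  The other
    types are separated by the existence of a Jordan chain of length 3, that is,
    of a vector [u] with [(A - c)^3 u = 0] and [(A - c)^2 u <> 0]: such a chain
    cannot exist if [A] preserves a plane of signature (1,1), because [A] is
    diagonalizable on the orthogonal complement ([no_long_chain]). *)

(** * Conjugate transposes and the Hermitian form *)

Section Conj.
Variable C : numClosedFieldType.
Implicit Types x y : C.

Lemma conjCM x y : (x * y)^* = x^* * y^*. Proof. exact: rmorphM. Qed.
Lemma conjCD x y : (x + y)^* = x^* + y^*. Proof. exact: rmorphD. Qed.
Lemma conjCN x : (- x)^* = - x^*. Proof. exact: rmorphN. Qed.
Lemma conjCV x : (x^-1)^* = (x^*)^-1. Proof. exact: fmorphV. Qed.

Definition conjE :=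
  (conjCM, conjCD, conjCN, conjCV, @conjC0 C, @conjC1 C, @conjCK C).

Lemma norm1_conj x : `|x| = 1 -> x * x^* = 1.
Proof. by move=> x1; rewrite -normCK x1 expr1n. Qed.

Lemma norm1_neq0 x : `|x| = 1 -> x != 0.
Proof. by move=> x1; rewrite -normr_eq0 x1 oner_eq0. Qed.

End Conj.

Section Conjtr.
Variable R : realType.
Local Notation C := R[i].

Lemma conjtrK p q (X : 'M[C]_(p, q)) : conjtr (conjtr X) = X.
Proof. by apply/matrixP=> i j; rewrite !mxE conjCK. Qed.

Lemma conjtr_row p q r (X : 'M[C]_(p, q)) (Y : 'M[C]_(p, r)) :
  conjtr (row_mx X Y) = col_mx (conjtr X) (conjtr Y).
Proof. by rewrite /conjtr map_row_mx tr_row_mx. Qed.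

Lemma conjtr_col p q r (X : 'M[C]_(p, r)) (Y : 'M[C]_(q, r)) :
  conjtr (col_mx X Y) = row_mx (conjtr X) (conjtr Y).
Proof. by rewrite /conjtr map_col_mx tr_col_mx. Qed.

Lemma conjtr_block p q r s (X : 'M[C]_(p, q)) (Y : 'M[C]_(p, r))
    (Z : 'M[C]_(s, q)) (T : 'M[C]_(s, r)) :
  conjtr (block_mx X Y Z T) =
  block_mx (conjtr X) (conjtr Z) (conjtr Y) (conjtr T).
Proof. by rewrite /conjtr map_block_mx tr_block_mx. Qed.

Lemma conjtrZ p q (c : C) (X : 'M[C]_(p, q)) : conjtr (c *: X) = c^* *: conjtr X.
Proof. by apply/matrixP=> i j; rewrite !mxE conjE. Qed.

Lemma conjtr0 p q : conjtr (0 : 'M[C]_(p, q)) = 0.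
Proof. by apply/matrixP=> i j; rewrite !mxE conjC0. Qed.

Lemma conjtr_diag p (a : 'rV[C]_p) : conjtr (diag_mx a) = diag_mx (map_mx Num.conj a).
Proof.
apply/matrixP=> i j; rewrite !mxE eq_sym.
by case: eqP => [->|_]; rewrite ?mulr1n ?mulr0n ?conjC0.
Qed.

End Conjtr.

Section Herm.
Variables (R : realType) (n : nat).
Local Notation C := R[i].
Local Notation V := 'cV[C]_n.+1.
Local Notation J := (Jmx R n).
Implicit Types (u v w x y z p q : V) (c : C).

Lemma hermE u v :
  herm u v = - (u ord0 0 * (v ord0 0)^*)
             + \sum_(j < n) u (lift ord0 j) 0 * (v (lift ord0 j) 0)^*.
Proof.
rewrite /herm mul_mx_diag !mxE big_ord_recl !mxE eqxx mulrN1 mulNr mulrC.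
by congr (_ + _); apply: eq_bigr => j _; rewrite !mxE /= mulr1 mulrC.
Qed.

Lemma conjtrJ : conjtr J = J.
Proof.
rewrite conjtr_diag; congr diag_mx; apply/rowP=> j; rewrite !mxE.
by case: ifP; rewrite !conjE.
Qed.

Lemma JJ : J *m J = 1%:M.
Proof.
rewrite mul_diag_mx; apply/matrixP=> i j; rewrite !mxE.
case: (i == j); rewrite ?mulr1n ?mulr0n ?mulr0 //.
by case: ifP; rewrite ?mulr1 // mulrNN mulr1.
Qed.

Lemma herm_sym u v : herm v u = (herm u v)^*.
Proof.
rewrite !hermE !conjE rmorph_sum mulrC; congr (_ + _).
by apply: eq_bigr => j _; rewrite /= !conjE mulrC.
Qed.

Lemma hermDl u v w : herm (u + v) w = herm u w + herm v w.
Proof. by rewrite /herm mulmxDr mxE. Qed.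
Lemma hermZl c u v : herm (c *: u) v = c * herm u v.
Proof. by rewrite /herm -scalemxAr mxE. Qed.
Lemma hermNl u v : herm (- u) v = - herm u v.
Proof. by rewrite -scaleN1r hermZl mulN1r. Qed.
Lemma herm0l v : herm 0 v = 0.
Proof. by rewrite /herm mulmx0 mxE. Qed.
Lemma hermDr u v w : herm w (u + v) = herm w u + herm w v.
Proof. by rewrite herm_sym hermDl conjE -!herm_sym. Qed.
Lemma hermZr c u v : herm v (c *: u) = c^* * herm v u.
Proof. by rewrite herm_sym hermZl conjE -herm_sym. Qed.
Lemma hermNr u v : herm v (- u) = - herm v u.
Proof. by rewrite -scaleN1r hermZr !conjE mulN1r. Qed.

Definition hermL := (hermDl, hermZl, hermNl, hermDr, hermZr, hermNr).

Lemma herm_real u : herm u u \is Num.real.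
Proof. by rewrite CrealE -herm_sym. Qed.

Lemma herm0_sym u v : herm u v = 0 -> herm v u = 0.
Proof. by move=> uv; rewrite herm_sym uv conjE. Qed.

Lemma nonpos_coord0 u : u ord0 0 = 0 -> herm u u <= 0 -> u = 0.
Proof.
move=> u0; rewrite hermE u0 mul0r oppr0 add0r => le0.
have ge0 j : true -> 0 <= u (lift ord0 j) 0 * (u (lift ord0 j) 0)^*.
  by move=> _; apply: mul_conjC_ge0.
have /eqP : \sum_(j < n) u (lift ord0 j) 0 * (u (lift ord0 j) 0)^* = 0.
  by apply/eqP; rewrite eq_le le0 sumr_ge0.
rewrite psumr_eq0 // => /allP uj; apply/colP=> i; rewrite mxE.
case: (unliftP ord0 i) => [j|] -> //.
by have := uj j (mem_index_enum _); rewrite mul_conjC_eq0 => /eqP.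
Qed.

(** A nonpositive subspace has dimension at most 1: the combination of [u] and
    [v] whose timelike coordinate vanishes is nonpositive by orthogonality, and
    the form is positive definite on the vectors with zero timelike
    coordinate. *)
Lemma nonpos_orth_dep u v :
  herm u u <= 0 -> herm v v <= 0 -> herm u v = 0 ->
  v ord0 0 *: u = u ord0 0 *: v.
Proof.
move=> u0 v0 uv; apply/eqP; rewrite -subr_eq0; apply/eqP.
apply: nonpos_coord0; first by rewrite !mxE mulrC subrr.
rewrite !hermL (herm0_sym uv) uv !(mulrN, mulr0, oppr0, addr0, add0r) opprK !mulrA.
by rewrite -[leRHS]addr0 lerD ?mulr_ge0_le0 ?mul_conjC_ge0.
Qed.

Lemma coord0_neq0 u : u != 0 -> herm u u <= 0 -> u ord0 0 != 0.
Proof. by move=> un0 hu; apply: contra_neq un0 => u0; apply: nonpos_coord0. Qed.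

Lemma null_orth_dep p v : p != 0 -> herm p p = 0 -> herm v p = 0 ->
  herm v v <= 0 -> v = (v ord0 0 / p ord0 0) *: p.
Proof.
move=> p0 pp vp vv; have c0 : p ord0 0 != 0 by rewrite coord0_neq0 ?pp.
have := nonpos_orth_dep vv (_ : herm p p <= 0) vp; rewrite pp => /(_ (lexx 0)) e.
by rewrite mulrC -scalerA -e scalerA mulVf ?scale1r.
Qed.

Lemma neg_orth_pos z v : herm z z < 0 -> herm v z = 0 -> v != 0 -> 0 < herm v v.
Proof.
move=> zz vz v0; rewrite real_ltNge ?real0 ?herm_real //; apply/negP=> vv.
have := nonpos_orth_dep vv (ltW zz) vz => /(congr1 (fun w => herm w z)).
rewrite !hermL vz mulr0 => /esym/eqP; rewrite mulf_eq0 (lt_eqF zz) orbF.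
by apply/negP; exact: coord0_neq0.
Qed.


(** The orthogonal of the column space of [M] is nonzero and stable under the
    inverse of [A], which has the same eigenvectors as [A]. *)
Lemma eigenvector_orth k (A : 'M[C]_n.+1) (M : 'M[C]_(n.+1, k)) (b : 'M[C]_k) :
  unitary_form A -> A *m M = M *m b -> (k < n.+1)%N ->
  exists x a, [/\ x != 0, A *m x = a *: x & conjtr M *m J *m x = 0].
Proof.
case/andP=> uA /eqP fA AM kn; set N := conjtr M *m J.
have NA : N *m invmx A = conjtr b *m N.
  have fA' : conjtr A *m J = J *m invmx A by rewrite -[in RHS]fA mulmxK.
  by rewrite /N [RHS]mulmxA -conjtrM -AM conjtrM -[RHS]mulmxA fA' mulmxA.
have [r [L [r0 Lfree LN subL]]] : exists r (L : 'M_(r, n.+1)),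
    [/\ (0 < r)%N, row_free L, L *m N^T = 0
      & forall Z : 'M_(r, n.+1), Z *m N^T = 0 -> (Z <= L)%MS].
  exists (\rank (kermx N^T)), (row_base (kermx N^T)).
  split; rewrite ?row_base_free //.
  - by rewrite mxrank_ker subn_gt0 (leq_ltn_trans (rank_leq_col _)).
  - by apply/sub_kermxP; rewrite eq_row_base.
  - by move=> Z ZN; rewrite eq_row_base; apply/sub_kermxP.
have NK : N *m L^T = 0 by apply: trmx_inj; rewrite trmx_mul trmxK LN trmx0.
have [Y KY] : exists Y, invmx A *m L^T = L^T *m Y.
  have /subL/submxP[Y eY] : (invmx A *m L^T)^T *m N^T = 0.
    by rewrite -trmx_mul mulmxA NA -mulmxA NK mulmx0 trmx0.
  by exists Y^T; apply: trmx_inj; rewrite eY trmx_mul !trmxK.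
have [a /eigenvalueP[y yY y0]] := eigenvalue_closed Y^T r0.
pose x := L^T *m y^T; have x0 : x != 0.
  by rewrite /x -trmx_mul trmx_eq0 mulmx_free_eq0.
have Ax : invmx A *m x = a *: x.
  rewrite mulmxA KY -mulmxA scalemxAr; congr (_ *m _); apply: trmx_inj.
  by rewrite trmx_mul trmxK yY linearZ /= trmxK.
exists x, a^-1; split=> //; last by rewrite mulmxA NK mul0mx.
have xE : x = a *: (A *m x) by rewrite scalemxAr -Ax mulKVmx.
have a0 : a != 0 by apply: contra_neq x0 => a0; rewrite xE a0 scale0r.
by rewrite {2}xE scalerA mulVf ?scale1r.
Qed.

End Herm.

(** * Splitting off orthonormal eigenvectors *)

Lemma mulmx1_rectC (C : fieldType) N M (P : 'M[C]_(N, M)) (Q : 'M[C]_(M, N)) :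
  N = M -> Q *m P = 1%:M -> P *m Q = 1%:M.
Proof. by move=> eNM; case: M / eNM P Q => P Q /mulmx1C. Qed.

Section Frames.
Variables (R : realType) (n : nat).
Local Notation C := R[i].
Local Notation V := 'cV[C]_n.+1.
Local Notation J := (Jmx R n).

Lemma herm_mulmx d (F : 'M[C]_(n.+1, d)) (x : V) (y : 'cV[C]_d) :
  herm x (F *m y) = (conjtr y *m (conjtr F *m J *m x)) 0 0.
Proof. by rewrite /herm conjtrM !mulmxA. Qed.

Lemma herm_unitary (A : 'M[C]_n.+1) (x y : V) :
  unitary_form A -> herm (A *m x) (A *m y) = herm x y.
Proof.
by case/andP=> _ /eqP fA; rewrite /herm conjtrM -[in RHS]fA !mulmxA.
Qed.

Lemma gramC p q (X : 'M[C]_(n.+1, p)) (Y : 'M[C]_(n.+1, q)) :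
  conjtr X *m J *m Y = conjtr (conjtr Y *m J *m X).
Proof. by rewrite !conjtrM conjtrJ conjtrK mulmxA. Qed.

Lemma eigen_norm1 (A : 'M[C]_n.+1) (x : V) a :
  unitary_form A -> A *m x = a *: x -> herm x x != 0 -> `|a| = 1.
Proof.
move=> uA Ax xx; have := herm_unitary x x uA; rewrite Ax hermZl hermZr mulrA.
rewrite -normCK -[RHS]mul1r => /(mulIf xx)/eqP.
by rewrite sqrp_eq1 // => /eqP.
Qed.

(** Spectral theorem on the orthogonal of [F].  For [d = 0] it serves to produce
    null eigenvectors, for [d > 0] to diagonalize [A] on the complement of a
    Lorentzian invariant subspace. *)
Lemma complete_frame d m (A : 'M[C]_n.+1) (F : 'M[C]_(n.+1, d)) (b : 'M[C]_d) :
  unitary_form A -> A *m F = F *m b -> (d + m <= n.+1)%N ->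
  (forall x a, x != 0 -> A *m x = a *: x -> conjtr F *m J *m x = 0 ->
     0 < herm x x) ->
  exists (W : 'M[C]_(n.+1, m)) (a : 'rV[C]_m),
    [/\ conjtr F *m J *m W = 0, conjtr W *m J *m W = 1%:M,
        A *m W = W *m diag_mx a & forall i, `|a 0 i| = 1].
Proof.
move=> uA AF le_dm posF; elim: m le_dm => [|m IHm] le_dm.
  exists 0, 0; split; rewrite ?mulmx0 ?mul0mx //; first by apply/matrixP=> [][].
  by case.
have [|W [a [FW WW AW a1]]] := IHm; first by rewrite (leq_trans _ le_dm) ?leq_add2l.
have AM : A *m row_mx F W = row_mx F W *m block_mx b 0 0 (diag_mx a).
  by rewrite mul_mx_row mul_row_block !mulmx0 addr0 add0r AF AW.
have [|x [c [x0 Ax]]] := eigenvector_orth uA AM; first by rewrite -addnS.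
rewrite conjtr_row !mul_col_mx -[X in _ = X -> _]vsubmxK !linear0.
case/eq_col_mx=> Fx Wx; have xx := posF x c x0 Ax Fx.
have c1 := eigen_norm1 uA Ax (lt0r_neq0 xx).
(* A positive eigenvector orthogonal to the family, once normalized, extends it. *)
pose s := sqrtC (herm x x); pose x' := s^-1 *: x.
have s0 : 0 < s by rewrite sqrtC_gt0.
have x'x' : conjtr x' *m J *m x' = 1%:M.
  apply/rowP=> j; rewrite !ord1 [RHS]mxE -[LHS]/(herm x' x') hermZl hermZr.
  rewrite conjE (CrealP _) ?gtr0_real // mulrA -expr2 exprVn sqrtCK mulVf //.
  exact: lt0r_neq0.
have Wx' : conjtr W *m J *m x' = 0 by rewrite -scalemxAr Wx scaler0.
have x'W : conjtr x' *m J *m W = 0 by rewrite gramC Wx' conjtr0.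
rewrite -[m.+1]add1n; exists (row_mx x' W), (row_mx (const_mx c) a); split.
- by rewrite mul_mx_row -scalemxAr Fx FW scaler0 row_mx0.
- rewrite conjtr_row !mul_col_mx !mul_mx_row x'x' x'W Wx' WW.
  by rewrite -/(block_mx 1%:M 0 0 1%:M) -scalar_mx_block.
- rewrite diag_mx_row mul_row_block !mulmx0 addr0 add0r mul_mx_row AW.
  rewrite diag_const_mx mul_mx_scalar -scalemxAr Ax scalerA mulrC -scalerA //.
- move=> i; rewrite mxE; case: splitP => j _; last exact: a1.
  by rewrite mxE.
Qed.

(** Rectangular matrices [P] and [Q] inverse to each other avoid casts between
    [n.+1] and [d + m]. *)
Lemma frame_basis d m (A : 'M[C]_n.+1) (F : 'M[C]_(n.+1, d)) (b : 'M[C]_d) y :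
  unitary_form A -> A *m F = F *m b -> n.+1 = (d + m)%N ->
  conjtr F *m J *m F \in unitmx -> herm (F *m y) (F *m y) < 0 ->
  exists (W : 'M[C]_(n.+1, m)) (a : 'rV[C]_m) (Q : 'M[C]_(d + m, n.+1)),
    [/\ row_mx F W *m Q = 1%:M, Q *m row_mx F W = 1%:M,
        conjtr (row_mx F W) *m J *m row_mx F W =
          block_mx (conjtr F *m J *m F) 0 0 1%:M,
        A *m row_mx F W = row_mx F W *m block_mx b 0 0 (diag_mx a)
      & forall i, `|a 0 i| = 1].
Proof.
move=> uA AF eN uG negy; have [||W [a [FW WW AW a1]]] := complete_frame uA AF (m := m).
- by rewrite eN.
- move=> x a x0 _ Fx; apply: neg_orth_pos negy _ x0.
  by rewrite herm_mulmx Fx mulmx0 mxE.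
pose P := row_mx F W; set G := conjtr F *m J *m F in uG *.
have gP : conjtr P *m J *m P = block_mx G 0 0 1%:M.
  rewrite conjtr_row !mul_col_mx !mul_mx_row FW WW.
  suff -> : conjtr W *m J *m F = 0 by [].
  by rewrite gramC FW conjtr0.
pose Q := block_mx (invmx G) 0 0 1%:M *m (conjtr P *m J).
have QP : Q *m P = 1%:M.
  rewrite -mulmxA gP mulmx_block !(mul0mx, mulmx0, addr0, add0r) mulVmx // mul1mx.
  by rewrite -scalar_mx_block.
exists W, a, Q; split=> //; first exact: mulmx1_rectC.
by rewrite mul_mx_row mul_row_block !mulmx0 addr0 add0r AF AW.
Qed.

End Frames.

(** * Elements without negative eigenvectors *)

Lemma covector_horner (K : fieldType) n (f : 'rV[K]_n.+1) (A : 'M[K]_n.+1) a g :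
  f *m A = a *: f -> f *m horner_mx A g = g.[a] *: f.
Proof.
move=> fA; elim/poly_ind: g => [|g c IHg].
  by rewrite rmorph0 mulmx0 horner0 scale0r.
rewrite rmorphD rmorphM /= horner_mx_X horner_mx_C mulmxDr mulmxA IHg.
by rewrite -scalemxAl fA mul_mx_scalar scalerA -scalerDl hornerMXaddC.
Qed.

(** A left eigenvector is detected by generalized right eigenvectors for the same
    eigenvalue: if [g] is the characteristic polynomial without its factors
    [X - a], then [f g(A) = g(a) f] is nonzero, while [(A - a)^e] kills the range
    of [g(A)] by the Cayley-Hamilton theorem. *)
Lemma covector_generalized (K : fieldType) n (f : 'rV[K]_n.+1) (A : 'M[K]_n.+1) a :
  f != 0 -> f *m A = a *: f ->
  exists (q : 'cV[K]_n.+1) e, (A - a%:M) ^+ e *m q = 0 /\ f *m q != 0.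
Proof.
move=> f0 fA; have [e [g]] := multiplicity_XsubC (char_poly A) a.
rewrite monic_neq0 ?char_poly_monic //= => ga chiE.
have [i fi] : exists i, f 0 i != 0 by apply/rV0Pn.
exists (horner_mx A g *m delta_mx i 0), e; split; last first.
  rewrite mulmxA (covector_horner _ fA) -scalemxAl -colE scaler_eq0 negb_or.
  apply/andP; split; first exact: ga.
  by apply/eqP=> /colP/(_ 0)/eqP; rewrite !mxE; apply/negP.
have -> : (A - a%:M) ^+ e = horner_mx A (('X - a%:P) ^+ e).
  by rewrite rmorphXn rmorphB /= horner_mx_X horner_mx_C.
by rewrite mulmxA mulmxE -rmorphM /= mulrC -chiE Cayley_Hamilton mul0mx.
Qed.

Lemma eigenvalue_tr (K : fieldType) n (A : 'M[K]_n) : eigenvalue A^T =1 eigenvalue A.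
Proof.
move=> a; rewrite !eigenvalue_root_char /char_poly -det_tr; congr (root (\det _) a).
by apply/matrixP=> i j; rewrite !mxE eq_sym.
Qed.

Section Structure.
Variables (R : realType) (n : nat).
Local Notation C := R[i].
Local Notation V := 'cV[C]_n.+1.
Local Notation J := (Jmx R n).
Variable A : 'M[C]_n.+1.
Hypothesis uA : unitary_form A.
Implicit Types (p q r x v : V) (a c : C).

(** If no eigenvector were null, all would be positive, and the space would have
    an orthonormal basis of positive vectors, against the sign of [J]. *)
Lemma null_eigenvector :
  (forall z a, herm z z < 0 -> A *m z <> a *: z) ->
  exists p a, [/\ p != 0, herm p p = 0 & A *m p = a *: p].
Proof.
move=> noneg; apply: contrapT => nonull.
have A0 : A *m (0 : 'M_(n.+1, 0)) = 0 *m (0 : 'M_0) by rewrite !mulmx0.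
have [//|x a x0 Ax _|W [a [_ WW _ _]]] := complete_frame uA A0 (m := n.+1).
  rewrite real_ltNge ?real0 ?herm_real // le_eqVlt negb_or.
  apply/andP; split; apply/negP=> xx; last exact: noneg xx Ax.
  by apply: nonull; exists x, a; split=> //; apply/eqP.
(* The entry (0, 0) of [W W^*] is a sum of squares, that of [J] is -1. *)
have := mulmx1C WW; rewrite mulmxA => /(congr1 (mulmx^~ J)).
rewrite mul1mx -(mulmxA _ J J) JJ mulmx1 => /matrixP/(_ ord0 ord0)/eqP.
rewrite !mxE eqxx mulr1n; apply/negP; rewrite gt_eqF //.
rewrite (@lt_le_trans _ _ 0) ?oppr_lt0 ?ltr01 // sumr_ge0 // => j _.
by rewrite !mxE mul_conjC_ge0.
Qed.

Lemma eigen_neq0 p a : p != 0 -> A *m p = a *: p -> a != 0.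
Proof.
move=> p0 Ap; apply: contra_neq p0 => a0; have /andP[Au _] := uA.
by rewrite -(mulKmx Au p) Ap a0 scale0r mulmx0.
Qed.

Lemma eigen_covector p a : p != 0 -> A *m p = a *: p ->
  conjtr p *m J *m A = a^*^-1 *: (conjtr p *m J).
Proof.
move=> p0 Ap; have a0 := eigen_neq0 p0 Ap; have /andP[_ /eqP fA] := uA.
apply: (scalerI (_ : a^* != 0)); first by rewrite conjC_eq0.
rewrite scalerA mulfV ?conjC_eq0 // scale1r -{2}fA !scalemxAl -conjtrZ -Ap.
by rewrite conjtrM !mulmxA.
Qed.

Lemma covector_herm p x : (conjtr p *m J *m x) = (herm x p)%:M.
Proof. by apply/rowP=> i; rewrite !ord1 [RHS]mxE mulr1n. Qed.


(** The covector [herm _ p] is a left eigenvector for [1 / conj a]; a right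
    eigenvector for this value is null, as its eigenvalue does not have modulus
    1, and cannot be proportional to [p], as the eigenvalues differ. *)
Lemma loxodromic_pair p a : p != 0 -> herm p p = 0 -> A *m p = a *: p ->
  `|a| != 1 ->
  exists q, [/\ herm q q = 0, herm q p = 1 & A *m q = a^*^-1 *: q].
Proof.
move=> p0 pp Ap a1; have a0 := eigen_neq0 p0 Ap.
have [p' p'0 Ap'] : exists2 x : V, x != 0 & A *m x = a^*^-1 *: x.
  have : eigenvalue A^T a^*^-1.
    rewrite eigenvalue_tr.
    apply/eigenvalueP; exists (conjtr p *m J); first exact: eigen_covector.
    apply: contra_neq p0 => /(congr1 (mulmx^~ J)).
    rewrite -mulmxA JJ mulmx1 mul0mx => /(congr1 (@conjtr R _ _)).
    by rewrite conjtrK conjtr0.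
  case/eigenvalueP=> y yA y0; exists y^T; first by rewrite trmx_eq0.
  by apply: trmx_inj; rewrite trmx_mul trmxK yA linearZ /= trmxK.
have a'1 : `|a^*^-1| != 1 by rewrite normfV norm_conjC invr_eq1.
have p'p' : herm p' p' = 0.
  by apply/eqP; apply: contraNT a'1 => /(eigen_norm1 uA Ap')/eqP.
have p'p : herm p' p != 0.
  apply: contra_neq a1 => /(null_orth_dep p0 pp); rewrite p'p' lexx => /(_ isT).
  set c := _ / _ => p'E; have c0 : c != 0.
    by apply: contra_neq p'0 => c0; rewrite p'E c0 scale0r.
  move: Ap'; rewrite p'E -scalemxAr Ap !scalerA => /eqP.
  rewrite -subr_eq0 -scalerBl scaler_eq0 (negPf p0) orbF subr_eq0 mulrC => /eqP.
  move=> /(mulIf c0) aE; apply/eqP; rewrite -sqrp_eq1 // normCK {1}aE mulVf //.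
  by rewrite conjC_eq0.
exists ((herm p' p)^-1 *: p'); rewrite !hermL p'p' !mulr0 mulVf //; split=> //.
by rewrite -scalemxAr Ap' scalerA mulrC -scalerA.
Qed.

(** Let [N = A - a].  For [v = N x] with [x], [v] orthogonal to [p] and [N v]
    proportional to [p], invariance of the form gives [herm v v = 0], so that [v]
    itself is proportional to [p]: along the chain of a generalized eigenvector
    the line of [p] is therefore reached at the second step. *)
Lemma jordan_chain p a : p != 0 -> herm p p = 0 -> A *m p = a *: p ->
  `|a| = 1 ->
  exists q v c, [/\ herm q q = 0, herm q p = 1, herm v p = 0,
    A *m q = a *: q + v & A *m v = a *: v + c *: p].
Proof.
move=> p0 pp Ap a1; have a0 := norm1_neq0 a1.
have aV : a^*^-1 = a by rewrite -[LHS]mul1r -(norm1_conj a1) mulfK ?conjC_eq0.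
pose f := conjtr p *m J; have fA : f *m A = a *: f by rewrite (eigen_covector p0 Ap) aV.
have f0 : f != 0.
  apply: contra_neq p0 => /(congr1 (mulmx^~ J)).
  rewrite -mulmxA JJ mulmx1 mul0mx => /(congr1 (@conjtr R _ _)).
  by rewrite conjtrK conjtr0.
have [q0 [e [Ne fq0]]] := covector_generalized f0 fA.
set N := A - a%:M in Ne; pose u k := N ^+ k *m q0.
have Np : N *m p = 0 by rewrite mulmxBl Ap mul_scalar_mx subrr.
have uS k : u k.+1 = N *m u k by rewrite /u exprS -mulmxE mulmxA.
have AE x : A *m x = a *: x + N *m x.
  by rewrite mulmxBl mul_scalar_mx addrC subrK.
have up k : herm (u k.+1) p = 0.
  have fN : f *m N = 0 by rewrite mulmxBr fA mul_mx_scalar subrr.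
  have : f *m u k.+1 = 0 by rewrite uS mulmxA fN mul0mx.
  by rewrite covector_herm => /(congr1 (fun M : 'M_1 => M 0 0)); rewrite !mxE.
have descent k : (exists c, u k.+3 = c *: p) -> exists c, u k.+2 = c *: p.
  case=> c uc; set v := u k.+2; set x := u k.+1.
  have := herm_unitary x v uA; rewrite !AE -!uS uc.
  rewrite !hermL !up !(mulr0, addr0) mulrA (norm1_conj a1) mul1r => /eqP.
  rewrite -subr_eq0 addrAC subrr add0r mulf_eq0 conjC_eq0 (negPf a0) => /eqP vv.
  have := null_orth_dep p0 pp (up k.+1); rewrite -/v vv lexx => /(_ isT) vE.
  by eexists; exact: vE.
have [c0 uc0] : exists c, u 2 = c *: p.
  have : exists c, u e.+2 = c *: p.
    by exists 0; rewrite scale0r !uS /u Ne !mulmx0.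
  by elim: e {Ne} => // k IHk /descent/IHk.
pose s := herm q0 p; have s0 : s != 0.
  apply: contra_neq fq0 => sE; rewrite covector_herm -/s sE; exact: raddf0.
have [q1 [q1p Aq1]] : exists q1, herm q1 p = 1 /\ A *m q1 = a *: q1 + s^-1 *: u 1.
  exists (s^-1 *: q0); split; first by rewrite hermZl; exact: mulVf.
  by rewrite AE -scalemxAr uS /u expr0 mul1mx.
(* Subtracting a multiple of [p] makes [q1] null and changes neither [N q1] nor
   [herm q1 p]. *)
exists (q1 - (herm q1 q1 / 2) *: p), (s^-1 *: u 1), (s^-1 * c0); split.
- rewrite !hermL pp q1p (herm_sym q1 p) q1p !conjE (CrealP (herm_real _)).
  by field.
- by rewrite !hermL pp q1p; ring.
- by rewrite hermZl up mulr0.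
- by rewrite mulmxBr Aq1 -scalemxAr Ap scalerBr !scalerA [a * _]mulrC addrAC.
- by rewrite AE -!scalemxAr -uS uc0 !scalerA.
Qed.

End Structure.

(** * Reversible matrices *)

(** The partial products of the sequence are generated by the parameter [x]: one
    step moves the partial product from [x] to [x * z] and exchanges the roles of
    the two factors.  Stability of the multisets [b] and [x :: c] under inversion
    is what remains invariant; it makes the corresponding diagonal matrices
    reversible. *)
Lemma inv_closed_factor (C : numClosedFieldType) (s : seq C) (x : C) :
  all [pred z | `|z| == 1] (x :: s) -> x * \prod_(z <- s) z = 1 ->
  exists b c, [/\ size b = size s, size c = size s,
    (forall i, s`_i = b`_i * c`_i),
    all [pred z | `|z| == 1] b /\ all [pred z | `|z| == 1] c
    & perm_eq (map GRing.inv b) b /\ perm_eq (map GRing.inv (x :: c)) (x :: c)].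
Proof.
elim: s x => [|z s IHs] x /=.
  rewrite big_nil mulr1 => _ ->; exists [::], [::]; split=> //.
    by move=> i; rewrite nth_nil mul0r.
  by rewrite /= invr1.
case/and3P=> /eqP x1 /eqP z1 s1; rewrite big_cons mulrA => pr.
have xz1 : `|x * z| = 1 by rewrite normrM x1 z1 mulr1.
have [|b [c [sb sc sE [b1 c1] [pb pc]]]] := IHs (x * z) _ pr.
  by rewrite /= s1 xz1 eqxx.
have x0 := norm1_neq0 x1.
exists (x * z :: c), (x^-1 :: b); rewrite /= sb sc xz1 normfV x1 invr1 eqxx c1 b1.
split=> //; first by case=> [|i] /=; rewrite ?sE [RHS]mulrC ?mulKf.
split=> //; rewrite invrK.
apply: (@perm_cat _ [:: x^-1; x] [:: x; x^-1]) => //.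
by apply/permPl; exact: (perm_catC [:: x^-1] [:: x]).
Qed.

Section Reversal.
Variable R : realType.
Local Notation C := R[i].

Definition isometry_mx d (G X : 'M[C]_d) := conjtr X *m G *m X = G.

(** The equation [g x g = x] says that [x] conjugates [g] to its inverse without
    mentioning this inverse. *)
Definition reversible_mx d (G g : 'M[C]_d) :=
  isometry_mx G g /\ exists2 x, isometry_mx G x & g *m x *m g = x.

Lemma reversible_mx1 d (G : 'M[C]_d) : reversible_mx G 1%:M.
Proof.
have iso1 : isometry_mx G 1%:M by rewrite /isometry_mx conjtr1 mul1mx mulmx1.
by split=> //; exists 1%:M; rewrite ?mulmx1.
Qed.

Lemma reversible_mx_block d e (G g : 'M[C]_d) (H h : 'M[C]_e) :
  reversible_mx G g -> reversible_mx H h ->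
  reversible_mx (block_mx G 0 0 H) (block_mx g 0 0 h).
Proof.
move=> [gG [x xG gx]] [hH [y yH hy]].
have iso (X : 'M_d) (Y : 'M_e) : isometry_mx G X -> isometry_mx H Y ->
    isometry_mx (block_mx G 0 0 H) (block_mx X 0 0 Y).
  rewrite /isometry_mx conjtr_block !conjtr0 !mulmx_block.
  by rewrite !(mul0mx, mulmx0, addr0, add0r) => -> ->.
split; first exact: iso; exists (block_mx x 0 0 y); first exact: iso.
by rewrite !mulmx_block !(mul0mx, mulmx0, addr0, add0r) gx hy.
Qed.

(** The permutation matching the entries with their inverses is the reversing
    isometry. *)
Lemma reversible_diag m (b : 'rV[C]_m) (t : m.-tuple C) :
  (forall i, b 0 i = tnth t i) -> all [pred z | `|z| == 1] t ->
  perm_eq (map GRing.inv t) t -> reversible_mx 1%:M (diag_mx b).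
Proof.
move=> bt /all_tnthP t1 /tuple_permP[s ts].
have b1 i : `|b 0 i| = 1 by rewrite bt; apply/eqP/t1.
have bs i : (b 0 i)^-1 = b 0 (s i).
  rewrite !bt [in LHS](tnth_nth 0) -(nth_map _ 0 GRing.inv) ?size_tuple //.
  by rewrite ts -[RHS](tnth_mktuple (fun j => tnth t (s j))) (tnth_nth 0).
split.
  rewrite /isometry_mx mulmx1 conjtr_diag mul_diag_mx; apply/matrixP=> i j.
  rewrite !mxE; case: eqP => [->|_]; rewrite ?mulr0 //.
  by rewrite !mulr1n mulrC norm1_conj.
exists (perm_mx s).
  rewrite /isometry_mx mulmx1 /conjtr map_perm_mx tr_perm_mx -perm_mxM mulVg.
  exact: perm_mx1.
rewrite mul_diag_mx mul_mx_diag; apply/matrixP=> i j; rewrite !mxE.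
case: eqP => [<-|_]; rewrite ?mulr0n ?mulr0 ?mul0r //.
by rewrite -bs mulr1 mulfV // norm1_neq0.
Qed.

Lemma diag_factor m (a : 'rV[C]_m) :
  (forall i, `|a 0 i| = 1) -> \prod_i a 0 i = 1 ->
  exists b c, [/\ reversible_mx 1%:M (diag_mx b), reversible_mx 1%:M (diag_mx c)
                & diag_mx a = diag_mx b *m diag_mx c].
Proof.
move=> a1 pa; have [s sa] : exists s : m.-tuple C, forall i, tnth s i = a 0 i.
  by exists [tuple a 0 i | i < m] => i; rewrite tnth_mktuple.
have [||b [c [sb sc sE [b1 c1] [pb pc]]]] := @inv_closed_factor C s 1.
- rewrite /= normr1 eqxx; apply/all_tnthP=> i.
  by rewrite /= sa a1.
- by rewrite mul1r big_tuple -[RHS]pa; apply: eq_bigr => i _; rewrite sa.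
rewrite size_tuple in sb sc; move/eqP in sb; move/eqP in sc.
pose tb := Tuple sb; pose tc := Tuple sc.
exists (\row_i tnth tb i), (\row_i tnth tc i); split.
- by apply: (@reversible_diag _ _ tb) => // i; rewrite mxE.
- apply: (@reversible_diag _ _ tc) => //; first by move=> i; rewrite mxE.
  by move: pc; rewrite /= invr1 perm_cons.
rewrite mul_diag_mx; apply/matrixP=> i j; rewrite !mxE; case: eqP => _; last first.
  by rewrite !mulr0n mulr0.
rewrite !mulr1n !(tnth_nth 0) /= -sE -sa (tnth_nth 0) //.
Qed.

End Reversal.

(** * From adapted bases to PU(n,1) *)

Section Columns.
Variables (K : fieldType) (n : nat).

Definition colspace d (F : 'M[K]_(n, d)) : {vspace 'cV[K]_n} :=
  limg (linfun (mulmx F) : 'Hom('cV_d, 'cV_n)).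

Lemma colspaceP d (F : 'M[K]_(n, d)) x :
  reflect (exists y, x = F *m y) (x \in colspace F).
Proof.
apply: (iffP memv_imgP) => [[y _ ->]|[y ->]]; first by exists y; rewrite lfunE.
by exists y; rewrite ?memvf // lfunE.
Qed.

Lemma dim_colspace d (F : 'M[K]_(n, d)) (L : 'M[K]_(d, n)) :
  L *m F = 1%:M -> \dim (colspace F) = d.
Proof.
move=> LF; rewrite /colspace limg_dim_eq ?dimvf; first exact: muln1.
apply/eqP; rewrite -subv0; apply/subvP=> y; rewrite memv_cap memvf memv_ker.
rewrite lfunE /= => /eqP Fy; rewrite memv0; apply/eqP.
by rewrite -[y]mul1mx -LF -mulmxA Fy mulmx0.
Qed.

End Columns.

Section Lift.
Variables (R : realType) (n N : nat).
Local Notation C := R[i].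
Local Notation J := (Jmx R n).
Variables (P : 'M[C]_(n.+1, N)) (Q : 'M[C]_(N, n.+1)) (G : 'M[C]_N).
Hypotheses (PQ : P *m Q = 1%:M) (QP : Q *m P = 1%:M).
Hypothesis gramP : conjtr P *m J *m P = G.

Lemma unitary_formE (A : 'M[C]_n.+1) : conjtr A *m J *m A = J -> unitary_form A.
Proof.
move=> fA; rewrite /unitary_form fA eqxx andbT.
have /mulmx1_unit[] // : (J *m conjtr A *m J) *m A = 1%:M.
by rewrite -!mulmxA (mulmxA _ J) fA JJ.
Qed.

Lemma lift_unitary X : isometry_mx G X -> unitary_form (P *m X *m Q).
Proof.
move=> XG; apply: unitary_formE; rewrite !conjtrM.
have -> : conjtr Q *m (conjtr X *m conjtr P) *m J *m (P *m X *m Q) =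
          conjtr Q *m (conjtr X *m (conjtr P *m J *m P) *m X) *m Q.
  by rewrite !mulmxA.
rewrite gramP XG -gramP -mulmxA -[conjtr P *m J *m P *m Q]mulmxA PQ mulmx1.
by rewrite mulmxA -conjtrM PQ conjtr1 mul1mx.
Qed.

Lemma liftM X Y : P *m X *m Q *m (P *m Y *m Q) = P *m (X *m Y) *m Q.
Proof. by rewrite -!mulmxA (mulmxA Q) QP mul1mx. Qed.

Lemma reversible_lift X (r : U_n1 R n) :
  val r = P *m X *m Q -> reversible_mx G X -> reversible (PU_of r).
Proof.
move=> rE [_ [x xG Xx]].
pose h : U_n1 R n := Sub (P *m x *m Q) (lift_unitary xG).
have rhr : (r * h * r = h)%g.
  by apply: val_inj; rewrite !val_UM rE /= !liftM Xx.
exists (PU_of h); rewrite -PU_ofV; apply: (mulgI (PU_of h)).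
rewrite /conjg mulVKg -!PU_ofM; congr PU_of.
by rewrite -[in RHS]rhr mulgK.
Qed.

End Lift.

Section Product.
Variables (R : realType) (n k m : nat).
Local Notation C := R[i].
Local Notation J := (Jmx R n).
Variables (F : 'M[C]_(n.+1, k.+1)) (W : 'M[C]_(n.+1, m)).
Variables (Q : 'M[C]_(k.+1 + m, n.+1)) (G : 'M[C]_k.+1) (y0 : 'cV[C]_k.+1).
Local Notation P := (row_mx F W).
Hypotheses (PQ : P *m Q = 1%:M) (QP : Q *m P = 1%:M).
Hypothesis gramP : conjtr P *m J *m P = block_mx G 0 0 1%:M.
Hypotheses (uG : G \in unitmx) (neg_y0 : herm (F *m y0) (F *m y0) < 0).

Lemma reflection_lift (S : U_n1 R n) s : `|s| = 1 ->
  val S = P *m block_mx s%:M 0 0 1%:M *m Q -> complex_reflection_U k S.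
Proof.
move=> s1 SE.
have PF y : F *m y = P *m col_mx y 0 by rewrite mul_row_col mulmx0 addr0.
have PW z : W *m z = P *m col_mx 0 z by rewrite mul_row_col mulmx0 add0r.
have QK x : Q *m (P *m x) = x by rewrite mulmxA QP mul1mx.
have SP x : val S *m (P *m x) = P *m (block_mx s%:M 0 0 1%:M *m x).
  by rewrite SE -!mulmxA QK.
have hermP x y : herm (P *m x) (P *m y) = (conjtr y *m block_mx G 0 0 1%:M *m x) 0 0.
  by rewrite herm_mulmx [conjtr P *m J *m _]mulmxA gramP mulmxA.
exists (colspace F), (colspace W), s; split; split=> //.
- split.
  + apply/eqP; rewrite eqEsubv subvf; apply/subvP=> x _.
    rewrite -[x]mul1mx -PQ -mulmxA -[Q *m x]vsubmxK mul_row_col.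
    by rewrite memv_add //; apply/colspaceP; eexists.
  + apply/eqP; rewrite -subv0; apply/subvP=> x; rewrite memv_cap memv0.
    case/andP=> /colspaceP[y ->] /colspaceP[z /(congr1 (mulmx Q))].
    rewrite PF PW !QK => /eq_col_mx[-> _]; rewrite col_mx0 mulmx0; exact: eqxx.
  + move=> _ _ /colspaceP[y ->] /colspaceP[z ->].
    rewrite PF PW hermP conjtr_col conjtr0 mul_row_block mul_row_col.
    by rewrite !(mul0mx, mulmx0, addr0, add0r) mxE.
- apply: (@dim_colspace _ _ _ _ (usubmx Q)).
  have := congr1 (@ulsubmx _ _ _ _ _) QP.
  by rewrite [1%:M]scalar_mx_block block_mxKul /ulsubmx -mul_usub_mx mul_mx_row row_mxKl.
- move=> _ /colspaceP[y ->] orth; suff -> : y = 0 by rewrite mulmx0.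
  rewrite -[y](mulKmx uG); suff -> : G *m y = 0 by rewrite mulmx0.
  apply/colP=> i; have /orth : F *m delta_mx i 0 \in colspace F.
    by apply/colspaceP; eexists.
  rewrite !PF hermP conjtr_col conjtr0 mul_row_block mul_row_col.
  rewrite !(mul0mx, mulmx0, addr0, add0r) -mulmxA.
  have -> : conjtr (delta_mx i 0 : 'cV[C]_k.+1) = delta_mx 0 i.
    by apply/matrixP=> a b; rewrite !mxE andbC; case: (_ && _); rewrite !conjE.
  by rewrite -rowE !mxE.
- by exists (F *m y0) => //; apply/colspaceP; eexists.
- move=> _ /colspaceP[y ->]; rewrite PF SP mul_block_col.
  by rewrite !(mul0mx, mulmx0, addr0, add0r) mul_scalar_mx scalemxAr scale_col_mx scaler0.
- move=> _ /colspaceP[z ->]; rewrite PW SP mul_block_col.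
  by rewrite !(mul0mx, mulmx0, addr0, add0r) mul1mx.
Qed.

(** The scalar [nu] that normalizes the determinant on [W] disappears in PU(n,1);
    what it takes away from [c] is left to the reflection. *)
Lemma product_of_frame (A : U_n1 R n) c (a : 'rV[C]_m) (g1 g2 : 'M[C]_k.+1) :
  `|c| = 1 -> (forall i, `|a 0 i| = 1) ->
  reversible_mx G g1 -> reversible_mx G g2 ->
  val A *m P = P *m block_mx (c *: (g1 *m g2)) 0 0 (diag_mx a) ->
  exists (rs : seq (PU_n1 R n)) (S : PU_n1 R n),
    [/\ (size rs <= 2)%N, (forall r, r \in rs -> reversible r),
        complex_reflection k S & PU_of A = ((\prod_(r <- rs) r) * S)%g].
Proof.
move=> c1 a1 rev1 rev2 AP.
have [nu [nu1 nuE]] : exists nu : C, `|nu| = 1 /\ nu ^+ m = \prod_i a 0 i.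
  have pa1 : `|\prod_i a 0 i| = 1 by rewrite normr_prod big1.
  case: (posnP m) => [m0 | m0]; last first.
    exists (m.-root (\prod_i a 0 i)); rewrite norm_rootC pa1 rootC1 //.
    by rewrite rootCK.
  exists 1; rewrite normr1 expr1n big1 // => i; move: (ltn_ord i).
  by rewrite {2}m0.
have nu0 := norm1_neq0 nu1.
have [||b1 [b2 [revb1 revb2 bE]]] := @diag_factor R m (nu^-1 *: a).
- by move=> i; rewrite mxE normrM normfV nu1 invr1 a1 mulr1.
- under eq_bigr do rewrite mxE.
  by rewrite big_split /= prodr_const card_ord -nuE exprVn mulVf // expf_neq0.
have rev_1 := reversible_mx_block rev1 revb1.
have rev_2 := reversible_mx_block rev2 revb2.
have isoS : isometry_mx (block_mx G 0 0 1%:M) (block_mx (c / nu)%:M 0 0 (1%:M : 'M_m)).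
  rewrite /isometry_mx conjtr_block !conjtr0 conjtr1 !mulmx_block.
  rewrite !(mul0mx, mulmx0, addr0, add0r) !mulmx1.
  have -> : conjtr (c / nu)%:M = (c / nu)^*%:M :> 'M[C]_k.+1.
    by apply/matrixP=> i j; rewrite !mxE eq_sym; case: eqP; rewrite ?conjC0.
  rewrite mul_scalar_mx mul_mx_scalar scalerA norm1_conj ?scale1r //.
  by rewrite normrM normfV c1 nu1 invr1 mulr1.
pose r1 : U_n1 R n := Sub _ (lift_unitary PQ gramP (proj1 rev_1)).
pose r2 : U_n1 R n := Sub _ (lift_unitary PQ gramP (proj1 rev_2)).
pose S : U_n1 R n := Sub _ (lift_unitary PQ gramP isoS).
exists [:: PU_of r1; PU_of r2], (PU_of S); split=> //.
- move=> r; rewrite !inE => /orP[]/eqP->.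
    exact: (reversible_lift PQ QP gramP (erefl (val r1)) rev_1).
  exact: (reversible_lift PQ QP gramP (erefl (val r2)) rev_2).
- exists S => //; apply: (@reflection_lift _ (c / nu)) => //.
  by rewrite normrM normfV c1 nu1 invr1 mulr1.
rewrite !big_cons big_nil mulg1 -!PU_ofM; apply/PU_ofP; exists nu => //.
rewrite !val_UM /= !(liftM QP) !mulmx_block !(mul0mx, mulmx0, addr0, add0r).
rewrite -bE mulmx1 -[LHS]mulmx1 -PQ [LHS]mulmxA AP [RHS]scalemxAl [nu *: _]scalemxAr.
rewrite scale_block_mx !scaler0 mul_mx_scalar scalerA mulrCA divff // mulr1.
by congr (_ *m block_mx _ _ _ _ *m _); apply/matrixP=> i j; rewrite !mxE mulrnAr mulVKf.
Qed.

End Product.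

(** * Isometries of Lorentzian spaces of dimension 2 and 3 *)

Section SmallMatrices.
Variable R : realType.
Local Notation C := R[i].

Definition mx_seq d (l : seq (seq C)) : 'M[C]_d :=
  \matrix_(i, j) (nth [::] l i)`_j.

Definition hyperbolic_plane : 'M[C]_2 := mx_seq 2 [:: [:: 0; 1]; [:: 1; 0]].

Definition lorentz_space : 'M[C]_3 :=
  mx_seq 3 [:: [:: 0; 0; 1]; [:: 0; 1; 0]; [:: 1; 0; 0]].

Local Ltac entries :=
  apply/matrixP=> [[[|[|[|//]]] ?] [[|[|[|//]]] ?]] //;
  rewrite !(mxE, big_ord_recl, big_ord0) /= ?conjE.

Lemma hyperbolic_plane_unit : hyperbolic_plane \in unitmx.
Proof.
have /mulmx1_unit[] // : hyperbolic_plane *m hyperbolic_plane = 1%:M.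
by entries; ring.
Qed.

Lemma lorentz_space_unit : lorentz_space \in unitmx.
Proof.
have /mulmx1_unit[] // : lorentz_space *m lorentz_space = 1%:M.
by entries; ring.
Qed.

Lemma reversible_diag2 (x : C) : x^* = x -> x != 0 ->
  reversible_mx hyperbolic_plane (mx_seq 2 [:: [:: x; 0]; [:: 0; x^-1]]).
Proof.
move=> xR x0; split; last exists hyperbolic_plane; rewrite /isometry_mx;
  by entries; rewrite ?xR; field.
Qed.

(** This hyperbolic element is conjugate to [diag(1/2, 2)] by the unipotent matrix
    of parameter [t / 3]; the reversing isometry is the conjugate of the exchange
    of the two basis vectors. *)
Lemma reversible_upper2 (t : C) : t^* = - t ->
  reversible_mx hyperbolic_plane (mx_seq 2 [:: [:: 2^-1; t / 2]; [:: 0; 2]]).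
Proof.
move=> tI; split; last exists
  (mx_seq 2 [:: [:: t / 3; 1 - (t / 3) ^+ 2]; [:: 1; - (t / 3)]]);
  by rewrite /isometry_mx; entries; rewrite ?conjE ?tI; field.
Qed.

(** The unipotent isometries of [lorentz_space] fixing the first basis vector, as
    soon as [s + conj s = - |c|^2]; the imaginary part of [s] is the vertical
    part of the translation. *)
Definition heisenberg (c s : C) : 'M[C]_3 :=
  mx_seq 3 [:: [:: 1; c; s]; [:: 0; 1; - c^*]; [:: 0; 0; 1]].

Lemma reversible_heisenberg (c : C) :
  reversible_mx lorentz_space (heisenberg c (- (c * c^*) / 2)).
Proof.
have [s sR sE] : exists2 s, s^* = s & s = - (c * c^*) / 2.
  by exists (- (c * c^*) / 2); rewrite // !conjE; field.
pose x : 'M[C]_3 := mx_seq 3 [:: [:: 1; 0; 0]; [:: 0; -1; 0]; [:: 0; 0; 1]].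
rewrite -sE.
have gG : conjtr (heisenberg c s) *m lorentz_space =
    mx_seq 3 [:: [:: 0; 0; 1]; [:: 0; 1; c^*]; [:: 1; - c; s]].
  by entries; rewrite ?sR; ring.
have gx : heisenberg c s *m x =
    mx_seq 3 [:: [:: 1; - c; s]; [:: 0; -1; - c^*]; [:: 0; 0; 1]].
  by rewrite /x; entries; ring.
split; last exists x; rewrite /isometry_mx ?gG ?gx ?sE /x;
  by entries; field.
Qed.

(** The commutator of Heisenberg translations is vertical, so splitting [c] as
    [t c + (1 - t) c] with [t] purely imaginary absorbs any vertical part; the
    value of [t] is dictated by that part. *)
Lemma heisenberg_factor (c s : C) : c != 0 -> s + s^* = - (c * c^*) ->
  exists c1 c2, heisenberg c s =
    heisenberg c1 (- (c1 * c1^*) / 2) *m heisenberg c2 (- (c2 * c2^*) / 2).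
Proof.
move=> c0 sE; have cc0 : c^* != 0 by rewrite conjC_eq0.
have [t [tE ->]] : exists t, t^* = - t /\ s = - (t + 2^-1) * (c * c^*).
  exists (- s / (c * c^*) - 2^-1); split; last by field; rewrite c0 cc0.
  rewrite !conjE; have -> : s^* = - (c * c^*) - s by rewrite -sE addrAC subrr add0r.
  by field; rewrite c0 cc0.
exists (t * c), ((1 - t) * c).
by entries; rewrite ?conjE ?tE; field.
Qed.

End SmallMatrices.

(** * The Lorentzian summand *)

Section Lorentz.
Variables (R : realType) (n : nat).
Local Notation C := R[i].
Local Notation V := 'cV[C]_n.+1.
Local Notation J := (Jmx R n).
Implicit Types (A : 'M[C]_n.+1) (p q x z : V) (a c t : C).

Definition cols d (s : seq V) : 'M[C]_(n.+1, d) := \matrix_(i, j) s`_j i 0.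

Lemma mul_cols A d s (b : 'M[C]_d) :
  (forall j : 'I_d, A *m s`_j = \sum_(k < d) b k j *: s`_k) ->
  A *m cols d s = cols d s *m b.
Proof.
move=> As; apply/matrixP=> i j.
transitivity ((A *m s`_j) i 0).
  by rewrite !mxE; apply: eq_bigr => k _; rewrite mxE.
by rewrite As summxE mxE; apply: eq_bigr => k _; rewrite !mxE mulrC.
Qed.

Lemma gram_cols d s :
  conjtr (cols d s) *m J *m cols d s = \matrix_(i, j) herm s`_j s`_i.
Proof.
apply/matrixP=> i j; rewrite [RHS]mxE /herm -!mulmxA !mxE.
apply: eq_bigr => k _; rewrite !mxE; congr (_ * _).
by apply: eq_bigr => l _; rewrite !mxE.
Qed.

Definition lorentz_frame d A (F : 'M[C]_(n.+1, d)) (b : 'M[C]_d) :=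
  [/\ A *m F = F *m b, conjtr F *m J *m F \in unitmx
    & exists y, herm (F *m y) (F *m y) < 0].

(** The data that [product_of_frame] needs on the Lorentzian summand. *)
Definition framed k A :=
  exists (F : 'M[C]_(n.+1, k.+1)) c g1 g2,
    [/\ lorentz_frame A F (c *: (g1 *m g2)), `|c| = 1,
        reversible_mx (conjtr F *m J *m F) g1
      & reversible_mx (conjtr F *m J *m F) g2].

Lemma frame_dim d (F : 'M[C]_(n.+1, d)) :
  conjtr F *m J *m F \in unitmx -> (d <= n.+1)%N.
Proof.
rewrite -row_free_unit => /eqP <-.
by rewrite (leq_trans (mxrankM_maxr _ _)) ?rank_leq_row.
Qed.

Lemma framed_product k (A : U_n1 R n) : framed k (val A) ->
  exists (rs : seq (PU_n1 R n)) (S : PU_n1 R n),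
    [/\ (size rs <= 2)%N, (forall r, r \in rs -> reversible r),
        complex_reflection k S & PU_of A = ((\prod_(r <- rs) r) * S)%g].
Proof.
case=> F [c [g1 [g2 [[AF uG [y negy]] c1 rev1 rev2]]]].
have eN : n.+1 = (k.+1 + (n.+1 - k.+1))%N by rewrite subnKC // (frame_dim uG).
have [W [a [Q [PQ QP gP AP a1]]]] := frame_basis (valP A) AF eN uG negy.
exact: (product_of_frame PQ QP gP uG negy c1 a1 rev1 rev2 AP).
Qed.

Lemma elliptic_framed A z a : unitary_form A ->
  herm z z < 0 -> A *m z = a *: z -> framed 0 A.
Proof.
move=> uA zz Az; exists z, a, 1%:M, 1%:M; split; try exact: reversible_mx1.
- split.
  + by rewrite mulmx1 Az scalemx1 mul_mx_scalar.
  + by rewrite covector_herm unitmxE det_scalar1 unitfE lt_eqF.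
  + by exists 1%:M; rewrite mulmx1.
- exact: eigen_norm1 uA Az (ltr0_neq0 zz).
Qed.

Lemma gram_pair p q : herm p p = 0 -> herm q q = 0 -> herm q p = 1 ->
  conjtr (cols 2 [:: p; q]) *m J *m cols 2 [:: p; q] = hyperbolic_plane R.
Proof.
move=> pp qq qp; rewrite gram_cols.
apply/matrixP=> [[[|[|//]] ?] [[|[|//]] ?]]; rewrite !mxE //=.
by rewrite herm_sym qp conjC1.
Qed.

Lemma null_pair_neg p q : herm p p = 0 -> herm q q = 0 -> herm q p = 1 ->
  herm (p - q) (p - q) < 0.
Proof.
move=> pp qq qp; rewrite !hermL (herm_sym q p) qp pp qq conjC1 oppr0 addr0 add0r.
by rewrite -opprD oppr_lt0 addr_gt0 ?ltr01.
Qed.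

Lemma pair_frame A (b : 'M[C]_2) p q :
  herm p p = 0 -> herm q q = 0 -> herm q p = 1 ->
  A *m p = b 0 0 *: p + b 1 0 *: q -> A *m q = b 0 1 *: p + b 1 1 *: q ->
  lorentz_frame A (cols 2 [:: p; q]) b.
Proof.
move=> pp qq qp Ap Aq; split.
- apply: mul_cols => j; rewrite !big_ord_recl big_ord0 addr0.
  by case: j => [[|[|//]] ?] /=; rewrite ?Ap ?Aq;
     congr (b _ _ *: _ + b _ _ *: _); apply: val_inj.
- by rewrite gram_pair ?hyperbolic_plane_unit.
- exists (\col_i [:: 1; -1]`_i).
  suff -> : cols 2 [:: p; q] *m \col_i [:: 1; -1]`_i = p - q.
    exact: null_pair_neg.
  by apply/colP=> i; rewrite !(mxE, big_ord_recl, big_ord0) /=; ring.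
Qed.


Lemma loxodromic_framed A p q a : a != 0 ->
  herm p p = 0 -> herm q q = 0 -> herm q p = 1 ->
  A *m p = a *: p -> A *m q = a^*^-1 *: q -> framed 1 A.
Proof.
move=> a0 pp qq qp Ap Aq; have na0 : `|a| != 0 by rewrite normr_eq0.
exists (cols 2 [:: p; q]), (a / `|a|),
  (mx_seq 2 [:: [:: `|a|; 0]; [:: 0; `|a|^-1]]), 1%:M.
rewrite gram_pair //; split; last exact: reversible_mx1.
- rewrite mulmx1; apply: pair_frame; rewrite // !mxE /= mulr0 scale0r ?addr0 ?add0r.
    by rewrite Ap divfK.
  rewrite Aq; congr (_ *: _); rewrite -mulrA -invfM -expr2 normCK invfM mulVKf //.
- by rewrite normrM normfV normr_id divff.
- by apply: reversible_diag2 => //; rewrite (CrealP _) ?normr_real.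
Qed.

(** A parabolic element of [SU(1,1)] is [diag(2, 1/2)] times an upper triangular
    hyperbolic element. *)
Lemma translation_framed A p q a t : unitary_form A -> `|a| = 1 ->
  herm p p = 0 -> herm q q = 0 -> herm q p = 1 ->
  A *m p = a *: p -> A *m q = a *: (q + t *: p) -> framed 1 A.
Proof.
move=> uA a1 pp qq qp Ap Aq; have pq : herm p q = 1 by rewrite herm_sym qp conjC1.
have tI : t^* = - t.
  have := herm_unitary q q uA; rewrite Aq hermZl hermZr mulrA (norm1_conj a1) mul1r.
  rewrite !hermL pp qq qp pq !mulr0 !mulr1 addr0 add0r => /eqP.
  by rewrite mulr1 addr_eq0 => /eqP.
exists (cols 2 [:: p; q]), a, (mx_seq 2 [:: [:: 2; 0]; [:: 0; 2^-1]]),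
  (mx_seq 2 [:: [:: 2^-1; t / 2]; [:: 0; 2]]).
rewrite gram_pair //; split=> //; last exact: reversible_upper2.
- apply: pair_frame; rewrite // ?Ap ?Aq ?scalerDr ?scalerA
    !(mxE, big_ord_recl, big_ord0) /=.
    rewrite -[LHS]addr0; congr (_ *: _ + _); first by field.
    by rewrite !mul0r !mulr0 !addr0 mulr0 scale0r.
  by rewrite addrC; congr (_ *: _ + _ *: _); field.
- apply: reversible_diag2; last by rewrite pnatr_eq0.
  exact: conjC_nat.
Qed.

Definition long_chain A :=
  exists c (u : V), let N := A - c%:M in
    N *m (N *m (N *m u)) = 0 /\ N *m (N *m u) != 0.

Lemma parabolic_framed A p r q a c s : `|a| = 1 -> c != 0 ->
  herm p p = 0 -> herm q q = 0 -> herm q p = 1 ->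
  herm r r = 1 -> herm r p = 0 -> herm r q = 0 -> s + s^* = - (c * c^*) ->
  A *m p = a *: p -> A *m r = a *: (r + c *: p) ->
  A *m q = a *: (q - c^* *: r + s *: p) -> framed 2 A.
Proof.
move=> a1 c0 pp qq qp rr rp rq sE Ap Ar Aq.
have pq : herm p q = 1 by rewrite herm_sym qp conjC1.
have gF : conjtr (cols 3 [:: p; r; q]) *m J *m cols 3 [:: p; r; q] = lorentz_space R.
  rewrite gram_cols; apply/matrixP=> [[[|[|[|//]]] ?] [[|[|[|//]]] ?]];
    rewrite !mxE //=.
    exact: herm0_sym.
  exact: herm0_sym.
have [c1 [c2 hE]] := heisenberg_factor c0 sE.
exists (cols 3 [:: p; r; q]), a, (heisenberg c1 (- (c1 * c1^*) / 2)),
  (heisenberg c2 (- (c2 * c2^*) / 2)).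
rewrite gF; split=> //; try exact: reversible_heisenberg.
rewrite -hE; split.
- apply: mul_cols => -[[|[|[|//]]] j3]; rewrite !(mxE, big_ord_recl, big_ord0) /=.
  + by rewrite Ap mulr1 !mulr0 !scale0r !addr0.
  + by rewrite Ar mulr1 mulr0 scale0r !addr0 scalerDr scalerA addrC.
  + rewrite Aq mulr1 addr0 !scalerDr scalerN mulrN scaleNr !scalerA.
    by rewrite [RHS]addrC [X in _ = X + _]addrC.
- by rewrite gF lorentz_space_unit.
- exists (\col_i [:: 1; 0; -1]`_i).
  suff -> : cols 3 [:: p; r; q] *m \col_i [:: 1; 0; -1]`_i = p - q.
    exact: null_pair_neg.
  by apply/colP=> i; rewrite !(mxE, big_ord_recl, big_ord0) /=; ring.
Qed.

(** In the chain [q, v, N v] of [jordan_chain], the vector [v] is null or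
    positive.  If null it is proportional to [p], and [p], [q] span [U]; if
    positive it is normalized to a unit vector [r] orthogonal to [p] and [q], and
    [p], [r], [q] span [U]. *)
Lemma nonelliptic_framed A : unitary_form A ->
  (forall z a, herm z z < 0 -> A *m z <> a *: z) ->
  framed 1 A \/ framed 2 A /\ long_chain A.
Proof.
move=> uA noneg; have [p [a [p0 pp Ap]]] := null_eigenvector uA noneg.
have a0 := eigen_neq0 uA p0 Ap.
have [a1|a1] := eqVneq `|a| 1; last first.
  have [q [qq qp Aq]] := loxodromic_pair uA p0 pp Ap a1.
  by left; apply: loxodromic_framed Ap Aq.
have [q [v [d [qq qp vp Aq Av]]]] := jordan_chain uA p0 pp Ap a1.
have pq : herm p q = 1 by rewrite herm_sym qp conjC1.
have pv : herm p v = 0 by exact: herm0_sym.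
have [vv|] := boolP (herm v v <= 0).
  have vE := null_orth_dep p0 pp vp vv; set t := _ / _ in vE.
  left; apply: (translation_framed (t := a^-1 * t)) uA a1 pp qq qp Ap _.
  by rewrite scalerDr scalerA mulrA divff // mul1r -vE.
rewrite -real_ltNge ?real0 ?herm_real // => vv; right.
pose rho := sqrtC (herm v v); have rho0 : 0 < rho by rewrite sqrtC_gt0.
have rhoR : rho^* = rho by rewrite (CrealP _) ?gtr0_real.
have rho2 : rho * rho = herm v v by rewrite -expr2 sqrtCK.
have rhoN0 := lt0r_neq0 rho0; clearbody rho.
have [r rE] : exists r, r = rho^-1 *: (v - herm v q *: p) by eexists.
have vE : v = rho *: r + herm v q *: p.
  by rewrite rE scalerA divff // scale1r subrK.
have rp : herm r p = 0 by rewrite rE !hermL vp pp; ring.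
have rq : herm r q = 0 by rewrite rE !hermL pq; ring.
have rr : herm r r = 1.
  rewrite rE !hermL vp pp pv -rho2 !conjE rhoR; by field.
have Ar : A *m r = a *: (r + (d / (rho * a)) *: p).
  rewrite rE -scalemxAr mulmxBr Av -scalemxAr Ap.
  by apply/colP=> i; rewrite !mxE; field; rewrite a0 rhoN0.
set c := d / _ in Ar; set e := rho / a; set s := herm v q / a.
have {}Aq : A *m q = a *: (q + e *: r + s *: p).
  by rewrite Aq {1}vE; apply/colP=> i; rewrite !mxE /e /s; field.
have e0 : e != 0 by rewrite mulf_neq0 ?invr_eq0.
clearbody c e s; have pr := herm0_sym rp; have qr := herm0_sym rq.
(* The two relations express that [A] preserves [herm r q] and [herm q q]. *)
have ec : e^* = - c.
  have := herm_unitary r q uA; rewrite Ar Aq hermZl hermZr mulrA (norm1_conj a1) mul1r.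
  rewrite !hermL rq rr rp pq pp pr => E.
  by apply/eqP; rewrite -addr_eq0; apply/eqP; rewrite -[RHS]E; ring.
have es : s + s^* = - (e * e^*).
  have := herm_unitary q q uA; rewrite Aq hermZl hermZr mulrA (norm1_conj a1) mul1r.
  rewrite !hermL rq rr rp pq pp pr qq qr qp => E.
  by apply/eqP; rewrite -addr_eq0; apply/eqP; rewrite -[RHS]E; ring.
have eE : e = - c^* by rewrite -[e]conjCK ec conjCN.
have c0 : c != 0 by apply: contra_neq e0 => c0; rewrite eE c0 conjC0 oppr0.
split.
  apply: (@parabolic_framed A p r q a c s) a1 c0 pp qq qp rr rp rq _ Ap Ar _.
    by rewrite es eE !conjE mulrNN mulrC.
  by rewrite Aq eE scaleNr.
have Np : (A - a%:M) *m p = 0 by rewrite mulmxBl Ap mul_scalar_mx subrr.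
have Nr : (A - a%:M) *m r = (a * c) *: p.
  by rewrite mulmxBl Ar mul_scalar_mx scalerDr addrAC subrr add0r scalerA.
have Nq : (A - a%:M) *m q = (a * e) *: r + (a * s) *: p.
  by rewrite mulmxBl Aq mul_scalar_mx; apply/colP=> i; rewrite !mxE; ring.
have NNq : (A - a%:M) *m ((A - a%:M) *m q) = (a * e * (a * c)) *: p.
  by rewrite Nq mulmxDr -2!scalemxAr Np Nr scaler0 addr0 scalerA.
exists a, q; rewrite /= NNq -scalemxAr Np scaler0; split=> //.
by rewrite scaler_eq0 !mulf_eq0 !negb_or a0 e0 c0 p0.
Qed.

End Lorentz.

(** * The type of the isometry determines the summand *)

(** By the Cayley-Hamilton theorem [b^2 = tr b . b] when [b] is singular, so
    that [b^3 y = 0] forces [tr b = 0] or [b y = 0]. *)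
Lemma mx2_chain (K : fieldType) (b : 'M[K]_2) (y : 'cV[K]_2) :
  b *m (b *m (b *m y)) = 0 -> b *m (b *m y) = 0.
Proof.
have bb z : b *m (b *m z) = \tr b *: (b *m z) - \det b *: z.
  rewrite mulmxA scalemxAl -[\det b *: z]mul_scalar_mx -mulmxBl; congr (_ *m z).
  have detb : \det b = b 0 0 * b 1 1 - b 0 1 * b 1 0.
    rewrite (expand_det_row _ 0) !big_ord_recl big_ord0 /cofactor !det_mx11 !mxE.
    have -> : lift 0 0 = 1 :> 'I_2 by apply: val_inj.
    have -> : lift 1 0 = 0 :> 'I_2 by apply: val_inj.
    by rewrite /= expr0 expr1 mul1r addr0 mulN1r mulrN.
  have trb : \tr b = b 0 0 + b 1 1.
    rewrite /mxtrace !big_ord_recl big_ord0 addr0; congr (_ + b _ _); exact: val_inj.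
  have I2 (i : 'I_2) : i = 0 \/ i = 1.
    by case: i => [[|[|//]] ?]; [left | right]; apply: val_inj.
  have mul2 i j : (b *m b) i j = b i 0 * b 0 j + b i 1 * b 1 j.
    rewrite mxE !big_ord_recl big_ord0 addr0; congr (_ + b _ _ * b _ _); exact: val_inj.
  apply/matrixP=> i j; rewrite mul2 !mxE detb trb.
  by case: (I2 i) => ->; case: (I2 j) => ->; rewrite ?mulr1n ?mulr0n; ring.
move=> b3; have [d0|dN0] := eqVneq (\det b) 0.
  have b2 z : b *m (b *m z) = \tr b *: (b *m z) by rewrite bb d0 scale0r subr0.
  move: b3; rewrite !b2 scalerA => /eqP; rewrite scaler_eq0 mulf_eq0 orbb -scaler_eq0.
  by move/eqP.
have ub : b \in unitmx by rewrite unitmxE unitfE.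
by rewrite -[RHS](mulmx0 _ (invmx b)) -b3 mulKmx.
Qed.

Section Exclusion.
Variables (R : realType) (n : nat).
Local Notation C := R[i].
Local Notation V := 'cV[C]_n.+1.
Local Notation J := (Jmx R n).
Implicit Types (A : 'M[C]_n.+1) (p q x z : V) (a c t : C).

Lemma long_chainZ A c : c != 0 -> long_chain A -> long_chain (c *: A).
Proof.
move=> c0 [a [u]] /=; set N := A - _ => -[N3 N2]; exists (c * a), u => /=.
have -> : c *: A - (c * a)%:M = c *: N by rewrite scalerBr scale_scalar_mx.
rewrite -!(scalemxAl, scalemxAr) N3 !scaler0; split=> //.
by rewrite !scaler_eq0 (negPf c0) (negPf N2).
Qed.

Lemma no_long_chain A (F : 'M[C]_(n.+1, 2)) b :
  unitary_form A -> lorentz_frame A F b -> ~ long_chain A.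
Proof.
move=> uA [AF uG [y0 negy]] [c [u]] /=; set N := A - _ => -[N3 N2].
have eN : n.+1 = (2 + (n.+1 - 2))%N by rewrite subnKC // (frame_dim uG).
have [W [a [Q [PQ QP gP AP a1]]]] := frame_basis uA AF eN uG negy.
set P := row_mx F W in PQ QP AP; pose D := diag_mx a - c%:M.
have NP (y : 'cV_2) (z : 'cV_(n.+1 - 2)) :
    N *m (P *m col_mx y z) = P *m col_mx ((b - c%:M) *m y) (D *m z).
  rewrite mulmxBl mulmxA AP mul_scalar_mx -mulmxA mul_block_col.
  rewrite !mul0mx addr0 add0r scalemxAr -mulmxBr scale_col_mx opp_col_mx add_col_mx.
  by rewrite !mulmxBl !mul_scalar_mx.
have P0 (x : 'cV_(2 + (n.+1 - 2))) : P *m x = 0 -> x = 0.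
  by move=> Px; rewrite -[x]mul1mx -QP -mulmxA Px mulmx0.
have uE : u = P *m col_mx (usubmx (Q *m u)) (dsubmx (Q *m u)).
  by rewrite vsubmxK mulmxA PQ mul1mx.
move: N3 N2; rewrite uE !NP => /P0; set y := usubmx _; set z := dsubmx _.
rewrite -[X in _ = X -> _]vsubmxK !linear0 => /eq_col_mx[/mx2_chain by0 Dz].
rewrite by0; suff -> : D *m (D *m z) = 0 by rewrite col_mx0 mulmx0 eqxx.
have DE (w : 'cV_(n.+1 - 2)) i : (D *m w) i 0 = (a 0 i - c) * w i 0.
  by rewrite mulmxBl mul_scalar_mx mul_diag_mx !mxE mulrBl.
apply/colP=> i; have /colP/(_ i) := Dz; rewrite !DE ![(0 : 'cV_ _) _ _]mxE => /eqP.
by rewrite !mulf_eq0 !orbA !orbb => /orP[] /eqP->; rewrite ?mulr0 ?mul0r.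
Qed.

Lemma basis_cols d (U : {vspace V}) (e : d.-tuple V) x : basis_of U e ->
  x \in U -> x = cols d e *m \col_i coord e i x.
Proof.
move=> eU xU; rewrite {1}(coord_basis eU xU); apply/colP=> i.
by rewrite summxE mxE; apply: eq_bigr => j _; rewrite !mxE mulrC.
Qed.

Lemma cols_basis d (U : {vspace V}) (e : d.-tuple V) (y : 'cV_d) : basis_of U e ->
  cols d e *m y \in U.
Proof.
move=> eU; have -> : cols d e *m y = \sum_i y i 0 *: e`_i.
  by apply/colP=> i; rewrite summxE mxE; apply: eq_bigr => j _; rewrite !mxE mulrC.
apply: memv_suml => i _; apply: memvZ; rewrite -(span_basis eU).
by apply: memv_span; rewrite mem_nth ?size_tuple.
Qed.

Lemma cols_free d (U : {vspace V}) (e : d.-tuple V) (y : 'cV_d) : basis_of U e ->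
  cols d e *m y = 0 -> y = 0.
Proof.
move=> eU y0; have /freeP fe := basis_free eU; apply/colP=> i; rewrite mxE.
apply: (fe (fun i => y i 0)); rewrite -[RHS]y0; apply/colP=> j.
by rewrite summxE mxE; apply: eq_bigr => k _; rewrite !mxE mulrC.
Qed.

Lemma invariant_basis d A (U : {vspace V}) (e : d.-tuple V) : basis_of U e ->
  Defs.invariant A U -> A *m cols d e = cols d e *m restriction_mx e A.
Proof.
move=> eU AU; apply: mul_cols => j; rewrite -tnth_nth.
have AeU : A *m tnth e j \in U.
  have ejU : tnth e j \in U by rewrite (basis_mem eU) ?mem_tnth.
  by have := subvP AU _ (memv_img (endo A) ejU); rewrite lfunE.
by rewrite (coord_basis eU AeU); apply: eq_bigr => k _; rewrite mxE.
Qed.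

Lemma basis_frame d A (U : {vspace V}) (e : d.-tuple V) : basis_of U e ->
  Defs.invariant A U -> Defs.nondegenerate U -> indefinite U ->
  lorentz_frame A (cols d e) (restriction_mx e A).
Proof.
move=> eU AU ndU [[z zU zz] _]; split; first exact: invariant_basis AU.
- rewrite -unitmx_tr -row_free_unit -kermx_eq0; apply/rowV0P=> w /sub_kermxP wG.
  apply: trmx_inj; rewrite trmx0; apply: (cols_free eU); apply: ndU.
    exact: cols_basis.
  move=> x xU; rewrite (basis_cols eU xU) herm_mulmx [_ *m J *m _]mulmxA.
  suff -> : conjtr (cols d e) *m J *m cols d e *m w^T = 0 by rewrite mulmx0 mxE.
  by apply: trmx_inj; rewrite trmx_mul trmxK wG trmx0.
- by exists (\col_i coord e i z); rewrite -(basis_cols eU zU).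
Qed.

Lemma vline_eigen A z : endo A z \in <[z]>%VS -> exists a, A *m z = a *: z.
Proof. by rewrite lfunE /= => /vlineP[a ->]; exists a. Qed.

Lemma fixed_line (A : U_n1 R n) z : PU_act (PU_of A) <[z]>%VS = <[z]>%VS ->
  exists a, val A *m z = a *: z.
Proof.
by rewrite PU_actE => fz; apply: vline_eigen; rewrite -fz memv_img ?memv_line.
Qed.

Lemma HCn_not_boundary (L : {vspace V}) : HCn L -> ~ boundary_HCn L.
Proof.
case=> z zz -> [p [p0 pp /esym pz]].
have /vlineP[c zE] : z \in <[p]>%VS by rewrite pz memv_line.
by move: zz; rewrite zE !hermL pp !mulr0 ltxx.
Qed.

Lemma elliptic_not_fixed (T : PU_n1 R n) (B : set {vspace V}) :
  elliptic T -> fixed_points T = B -> ~ (B `<=` @boundary_HCn R n)%classic.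
Proof.
case=> L LH TL fT BB; apply: (HCn_not_boundary LH); apply: BB; rewrite -fT.
by split=> //; left.
Qed.

Lemma elliptic_not_parabolic (T : PU_n1 R n) : elliptic T -> ~ parabolic T.
Proof.
by move=> eT [p pB fT]; apply: (elliptic_not_fixed eT fT) => _ ->.
Qed.

Lemma elliptic_not_hyperbolic (T : PU_n1 R n) : elliptic T -> ~ hyperbolic T.
Proof.
by move=> eT [p [q [pB qB _ fT]]]; apply: (elliptic_not_fixed eT fT) => _ [] ->.
Qed.

Lemma nonelliptic_eigen (A : U_n1 R n) : ~ elliptic (PU_of A) ->
  forall z a, herm z z < 0 -> val A *m z <> a *: z.
Proof.
move=> ell z a zz Az; apply: ell; exists <[z]>%VS; first by exists z.
rewrite PU_actE limg_line lfunE /= Az; apply/eqP; rewrite eqEsubv -!memvE.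
have a0 : a != 0.
  by apply: (eigen_neq0 (valP A) _ Az); apply: contraTneq zz => ->; rewrite herm0l ltxx.
rewrite memvZ ?memv_line //=; apply/vlineP; exists a^-1.
by rewrite scalerA mulVf ?scale1r.
Qed.

Lemma hyperbolic_frame (A : U_n1 R n) : hyperbolic (PU_of A) ->
  exists (F : 'M[C]_(n.+1, 2)) b, lorentz_frame (val A) F b.
Proof.
case=> p [q [[z [z0 zz pE]] [w [w0 ww qE]] pq fT]].
have fixT L : (L = p \/ L = q) -> PU_act (PU_of A) L = L.
  by move=> pqL; have [] : fixed_points (PU_of A) L by rewrite fT.
have [a Az] : exists a, val A *m z = a *: z.
  by apply: fixed_line; rewrite -pE; apply: fixT; left.
have [b Aw] : exists b, val A *m w = b *: w.
  by apply: fixed_line; rewrite -qE; apply: fixT; right.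
have wz : herm w z != 0.
  apply/eqP=> /(null_orth_dep z0 zz); rewrite ww lexx => /(_ isT) wE.
  apply: pq; rewrite pE qE; apply/esym/eqP; rewrite eqEdim !dim_vline z0 w0 /=.
  by rewrite -memvE andbT; apply/vlineP; eexists; exact: wE.
exists (cols 2 [:: z; (herm w z)^-1 *: w]), (mx_seq 2 [:: [:: a; 0]; [:: 0; b]]).
apply: pair_frame => //.
- by rewrite !hermL ww !mulr0.
- by rewrite hermZl mulVf.
- by rewrite !mxE /= scale0r addr0.
- by rewrite !mxE /= scale0r add0r -scalemxAr Aw scalerA mulrC -scalerA.
Qed.

Lemma lift_long_chain (A B : U_n1 R n) : PU_of A = PU_of B ->
  long_chain (val A) -> long_chain (val B).
Proof.
move=> /PU_ofP[l l1 ->] /(long_chainZ (_ : l^-1 != 0)).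
by rewrite invr_eq0 norm1_neq0 // scalerA mulVf ?norm1_neq0 // scale1r; apply.
Qed.

Lemma ellipto_translation_chain (A : U_n1 R n) :
  ellipto_translation (PU_of A) -> ~ long_chain (val A).
Proof.
case=> _ _ [B [l [U [W [[BA _ _] [_ [BU _] _ [ndU inU] [e eU _]]]]]]].
move=> /(lift_long_chain (esym BA)).
exact: no_long_chain (valP B) (basis_frame eU BU ndU inU).
Qed.

(** The minimal polynomial has degree 3 on the indefinite summand, hence a vector
    that is killed by [(A - l)^3] but not by [(A - l)^2]. *)
Lemma ellipto_parabolic_chain (A : U_n1 R n) :
  ellipto_parabolic (PU_of A) -> long_chain (val A).
Proof.
case=> _ _ [B [l [U [W [[BA _ _] [_ [BU _] _ [ndU inU] [e eU [_ minb]]]]]]]].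
apply: (lift_long_chain BA); set b := restriction_mx e (val B) in minb.
have BF := invariant_basis eU BU; rewrite -/b in BF.
have hE k : horner_mx b (('X - l%:P) ^+ k) = (b - l%:M) ^+ k.
  by rewrite rmorphXn rmorphB /= horner_mx_X horner_mx_C.
have b3 : (b - l%:M) ^+ 3 = 0 by rewrite -hE -minb mx_root_minpoly.
have b2 : (b - l%:M) ^+ 2 != 0.
  apply/eqP; rewrite -hE => /mxminpoly_min; rewrite minb => /dvdp_leq.
  by rewrite -size_poly_eq0 !size_exp_XsubC => /(_ isT).
have [y by2] : exists y : 'cV_3, (b - l%:M) ^+ 2 *m y != 0.
  have /matrix0Pn[i [j bij]] := b2; exists (delta_mx j 0).
  by rewrite -colE; apply: contra_neq bij => /colP/(_ i); rewrite !mxE.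
have NF (x : 'cV_3) : (val B - l%:M) *m (cols 3 e *m x) = cols 3 e *m ((b - l%:M) *m x).
  by rewrite !mulmxBl mulmxBr !mul_scalar_mx !mulmxA BF -scalemxAr.
have pw2 (x : 'cV_3) : (b - l%:M) *m ((b - l%:M) *m x) = (b - l%:M) ^+ 2 *m x.
  by rewrite expr2 -mulmxE mulmxA.
exists l, (cols 3 e *m y); rewrite /= !NF pw2; split.
  by rewrite [_ ^+ 2 *m _]mulmxA -[_ ^+ 2 *m _]exprSr b3 mul0mx mulmx0.
by rewrite pw2; apply: contra_neq by2; exact: (cols_free eU).
Qed.

End Exclusion.

Theorem corollary4p2 (R : realType) (n : nat) (T : PU_n1 R n) :
  exists k : nat,
    [/\ (k <= 2)%N,
        elliptic T -> k = 0%N,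
        ellipto_translation T \/ hyperbolic T -> k = 1%N,
        ellipto_parabolic T -> (2 < n)%N -> k = 2%N
      & exists (rs : seq (PU_n1 R n)) (S : PU_n1 R n),
          [/\ (size rs <= 2)%N,
              (forall r, r \in rs -> reversible r),
              complex_reflection k S
            & T = ((\prod_(r <- rs) r) * S)%g]].
Proof.
have [A ->] := PU_of_surj T.
have [eT|neT] := pselect (elliptic (PU_of A)).
  exists 0%N; split=> //.
  - case=> [[pT _ _]|hT]; first by case: (elliptic_not_parabolic eT pT).
    by case: (elliptic_not_hyperbolic eT hT).
  - by case=> pT _ _; case: (elliptic_not_parabolic eT pT).
  - have [L [z zz ->] /fixed_line[a Az]] := eT.
    exact: framed_product (elliptic_framed (valP A) zz Az).
have [fA|[fA chainA]] := nonelliptic_framed (valP A) (nonelliptic_eigen neT).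
  exists 1%N; split=> //; last exact: framed_product.
  move=> /ellipto_parabolic_chain chainA _; case: fA => F [c [g1 [g2 [lF _ _ _]]]].
  by case: (no_long_chain (valP A) lF chainA).
exists 2%N; split=> //; last exact: framed_product.
case=> [/ellipto_translation_chain //|/hyperbolic_frame[F [b lF]]].
by case: (no_long_chain (valP A) lF chainA).
Qed.
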